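(* Let $1\le K\le m$ be integers and let $r:[0,1]^K\to\mathbb{R}$ be a smooth index invariant reward function. For any $\boldsymbol{\mu}\in[0,1]^K$ and any small enough $\Delta>0$ there exists a CMAB problem $\underline{\nu}$ (with $m$ base arms, actions of size $K$ and reward function $r$) that is $J$-disjoint for some $J\subset[m]$, has minimal gap $\Delta$, and satisfies $\mathbb{E}[\nu_{S^*}]=\boldsymbol{\mu}$ (the vector of means of the arms in the optimal action $S^*$ is $\boldsymbol{\mu}$), such that for every consistent strategy the regret satisfies $$\liminf_{T\to\infty}\frac{\mathbb{E}_{\underline{\nu}}[R(T)]}{\ln T}\;\ge\;\max_{I\subsetneq[K]}\frac{(m-2K)\,\tilde\gamma_g^2(\boldsymbol{\mu};I)}{8\,K_I\,\Delta},\qquad K_I=K-|I|.$$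
   Context: Notation: $[n]=\{1,\dots,n\}$. CMAB problem. There are $m$ base arms. An action set $\mathcal{S}$ is a nonempty family of subsets of $[m]$, each of size exactly $K$. A CMAB problem $\underline{\nu}$ consists of an action set and a probability distribution on $[0,1]^m$ with mean vector $\boldsymbol\theta$. At each round $t$ a vector $X^{(t)}\in[0,1]^m$ is drawn from this distribution independently of other rounds; the agent chooses $S_t\in\mathcal{S}$ and observes $\{(i,X^{(t)}_i):i\in S_t\}$ (semi-bandit feedback). $\nu_S$ is the law of $(X_i^{(t)})_{i\in S}$, regarded as a law on $\mathbb{R}^K$ via an enumeration of $S$. Reward. A smooth index invariant reward function is a reward $r(S;\boldsymbol\theta)$, differentiable in $\boldsymbol\theta\in[0,1]^m$ for each action $S$, that depends only on the means of the arms in $S$: $r(S;\boldsymbol\theta)=r(\boldsymbol\theta_S)$, where $r:[0,1]^K\to\mathbb{R}$ is differentiable and does not depend on the order (symmetric in its $K$ arguments). Regret. $S^*\in\arg\max_{S\in\mathcal{S}}r(\boldsymbol\theta_S)$ is an optimal action, $\Delta_S=r(\boldsymbol\theta_{S^*})-r(\boldsymbol\theta_S)$, $R(T)=\sum_{t=1}^T\Delta_{S_t}$. The minimal gap of the problem is $\min_{S\in\mathcal{S}:\Delta_S>0}\Delta_S$. Strategies. A strategy $\psi$ chooses $S_{t+1}$ as a measurable function of the past observations and of internal i.i.d. randomization $U_0,U_1,\dots\in[0,1]$ (it may know the action set and $r$ but not the distribution). $N_{\psi,S}(T)$ is the number of times $S$ is chosen up to time $T$. $\psi$ is consistent if for any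 CMAB problem (with the given $m$, $K$, $r$), any action $S$ with $\Delta_S>0$ and any $0<\alpha\le1$, $\mathbb{E}[N_{\psi,S}(T)]=o(T^\alpha)$. $J$-disjoint. For $J\subset[m]$ a CMAB problem is $J$-disjoint if the arms in $J$ are mutually independent of the arms outside $J$, and $S_1\cap S_2=J$ for all $S_1\neq S_2\in\mathcal{S}$ (implicitly $|J|\le K$). Modified Gini-weighted smoothness. For $\boldsymbol\mu\in[0,1]^K$ and $I\subset[K]$, let $K_I=K-|I|$ and let $p=p^{\boldsymbol\mu,I}\in[0,1]^K$ be the vector whose first $K_I$ entries are the $\mu_i$, $i\notin I$, sorted in nondecreasing order, followed by the entries $\mu_i$, $i\in I$. Then $$\tilde\gamma_g^2(\boldsymbol\mu;I)=\sum_{i=1}^{K_I}p_i(1-p_i)\big(\nabla_i r(p)\big)^2+2\sum_{i=1}^{K_I}\sum_{j=i+1}^{K_I}p_i(1-p_j)\nabla_i r(p)\nabla_j r(p).$$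
   Formalization: The formal claim is for small Δ such that r(y)=r(μ)−Δ for some y in the cube differing from μ in at most m−K coordinates; this is necessary for a gap Δ, and without it the claim fails, e.g. for constant r, or μ=0 with r the sum, or m=K. *)

(* Defs.v *)
From HB Require Import structures.
From mathcomp Require Import all_boot all_order all_algebra perm.
From mathcomp Require Import all_classical all_reals all_analysis.

Set Implicit Arguments.
Unset Strict Implicit.
Unset Printing Implicit Defensive.
Import Order.TTheory GRing.Theory Num.Theory.
Import numFieldNormedType.Exports.
Local Open Scope classical_set_scope.
Local Open Scope ring_scope.

Section IidLaw.
Context d (T : measurableType d) (R : realType).

Definition cons_pair n (p : T * n.-tuple T) : n.+1.-tuple T :=
  [tuple of p.1 :: p.2].

Lemma measurable_cons_pair n : measurable_fun setT (@cons_pair n).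
Proof. exact: measurable_cons. Qed.

HB.instance Definition _ n :=
  isMeasurableFun.Build _ _ _ _ (@cons_pair n) (@measurable_cons_pair n).

(* The n-fold product measure of P on n.-tuple T. *)
Fixpoint iid (P : probability T R) (n : nat) : probability (n.-tuple T) R :=
  match n with
  | 0 => @dirac _ (0.-tuple T) [tuple] R
  | n'.+1 => distribution (P \x iid P n')%E (@cons_pair n')
  end.

End IidLaw.

(* A reward on [0,1]^K is represented by a function on all of R^K; everything
   below depends only on its values on the cube. *)
Section Reward.
Context (R : realType) (K : nat).
Implicit Types (r : 'rV[R]_K -> R) (x mu : 'rV[R]_K) (I : {set 'I_K}).

Definition cube : set 'rV[R]_K := [set x | forall i, 0 <= x 0 i <= 1].

(* Frechet derivative relative to the cube, hence one-sided on its boundary.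
   The cube being convex with nonempty interior, there is at most one such g
   at each point x of the cube. *)
Definition is_gradient r x (g : 'rV[R]_K) : Prop :=
  let F := within cube (nbhs x) in
  (fun y => r y - r x - \sum_i g 0 i * (y 0 i - x 0 i) : R^o)
    =o_F (fun y => y - x).

Definition gradient r x : 'rV[R]_K := xget 0 (is_gradient r x).

Definition smooth_index_invariant r : Prop :=
  (forall x, cube x -> exists g, is_gradient r x g) /\
  (forall (s : 'S_K) x, cube x -> r (col_perm s x) = r x).

(* The vector p^{mu,I}; the entries indexed by I are listed in index order. *)
Definition sorted_outside mu I : 'rV[R]_K :=
  \row_k nth 0 (sort <=%R [seq mu 0 i | i <- enum (~: I)] ++
                [seq mu 0 i | i <- enum I]) k.

(* The squared quantity gamma~_g^2(mu; I); indices start at 0. *)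
Definition gini_smoothness_sq r mu I : R :=
  let KI := (K - #|I|)%N in
  let p := sorted_outside mu I in
  let D := gradient r p in
  \sum_(i < K | (i < KI)%N) p 0 i * (1 - p 0 i) * D 0 i ^+ 2 +
  2 * \sum_(i < K | (i < KI)%N) \sum_(j < K | (i < j < KI)%N)
        p 0 i * (1 - p 0 j) * D 0 i * D 0 j.

(* Delta is a possible gap below an action of means mu: with m arms, another
   action of size K shares at least 2 K - m arms with it, so its mean vector
   differs from mu (up to order) in at most m - K coordinates. If some problem
   with m arms has an optimal action of means mu and an action of gap Delta,
   then this holds. *)
Definition attainable_gap (m : nat) r mu (Delta : R) : Prop :=
  exists y, [/\ cube y, (#|[pred i | y 0 i != mu 0 i]%R| <= m - K)%N &
                r y = r mu - Delta].

End Reward.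

Section Cmab.
Context (R : realType) (m K : nat).
Implicit Type r : 'rV[R]_K -> R.

Definition action_set (A : {set {set 'I_m}}) : Prop :=
  A != finset.set0 /\ (forall S, S \in A -> #|S| = K).

Record cmab := Cmab {
  actions : {set {set 'I_m}} ;
  actionsP : action_set actions ;
  law : probability (m.-tuple R) R ;
  law_support : law [set x | forall i, 0 <= tnth x i <= 1] = 1%E }.

Definition arm_mean (nu : cmab) (i : 'I_m) : R :=
  fine 'E_(law nu)[fun x => tnth x i].

(* Mean vector of nu_S, with the arms of S enumerated in increasing order. *)
Definition means_on (nu : cmab) (S : {set 'I_m}) : 'rV[R]_K :=
  \row_k nth 0 [seq arm_mean nu i | i <- enum S] k.

Definition optimal r (nu : cmab) (S : {set 'I_m}) : Prop :=
  S \in actions nu /\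
  forall S', S' \in actions nu -> r (means_on nu S') <= r (means_on nu S).

(* The base point of the maximum is irrelevant when S is an action. *)
Definition gap r (nu : cmab) (S : {set 'I_m}) : R :=
  \big[Num.max/r (means_on nu S)]_(S' in actions nu) r (means_on nu S')
  - r (means_on nu S).

(* +oo when every action is optimal. *)
Definition minimal_gap r (nu : cmab) : \bar R :=
  \big[mine/+oo%E]_(S in actions nu | 0 < gap r nu S) (gap r nu S)%:E.

Definition block (J : {set 'I_m}) (x : m.-tuple R) : m.-tuple R :=
  [tuple if i \in J then tnth x i else 0 | i < m].

(* J-disjointness; the second clause is the independence of the random vectors
   (X_i)_{i in J} and (X_i)_{i notin J}. *)
Definition disjoint_over (J : {set 'I_m}) (nu : cmab) : Prop :=
  [/\ (#|J| <= K)%N,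
      forall A B : set (m.-tuple R), measurable A -> measurable B ->
        law nu (block J @^-1` A `&` block (~: J) @^-1` B) =
        (law nu (block J @^-1` A) * law nu (block (~: J) @^-1` B))%E &
      forall S1 S2, S1 \in actions nu -> S2 \in actions nu -> S1 != S2 ->
        S1 :&: S2 = J].

(* Semi-bandit feedback {(i, x_i) : i in S}: a flag for each arm telling whether
   it is in S, with x_i if it is and the dummy value 0 otherwise. *)
Definition feedback (S : {set 'I_m}) (x : m.-tuple R) : m.-tuple (bool * R) :=
  [tuple if i \in S then (true, tnth x i) else (false, 0) | i < m].

(* choose A t (h, u): the action played in round t + 1 when the action set is A,
   where h lists (U_{s-1}, feedback of round s) for s = 1, ..., t and u = U_t.
   The common law of the seeds U_0, U_1, ... on [0,1] is part of the strategy.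
   A strategy receives the action set but not the law of the arms. *)
Record strategy := Strategy {
  seed_law : probability R R ;
  seed_support : seed_law [set u | 0 <= u <= 1] = 1%E ;
  choose : {set {set 'I_m}} ->
    forall t, t.-tuple (R * m.-tuple (bool * R)) * R -> {set 'I_m} ;
  choose_measurable : forall A t S, measurable [set h | @choose A t h = S] ;
  choose_action : forall A, action_set A -> forall t h, @choose A t h \in A }.

(* A run is a sequence w of pairs w t = (U_t, X^(t+1)). *)
Fixpoint history (psi : strategy) (A : {set {set 'I_m}})
    (w : nat -> R * m.-tuple R) (t : nat) :
    t.-tuple (R * m.-tuple (bool * R)) :=
  match t with
  | 0 => [tuple]
  | t'.+1 =>
      let h := history psi A w t' in
      let S := choose psi A (h, (w t').1) in
      [tuple of rcons h ((w t').1, feedback S (w t').2)]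
  end.

(* S_{t+1} *)
Definition played (psi : strategy) (A : {set {set 'I_m}})
    (w : nat -> R * m.-tuple R) (t : nat) : {set 'I_m} :=
  choose psi A (history psi A w t, (w t).1).

Definition run T (w : T.-tuple (R * m.-tuple R)) : nat -> R * m.-tuple R :=
  nth (0, [tuple of nseq m 0]) w.

(* Joint law of (U_0, X^(1)), ..., (U_{T-1}, X^(T)), which determine the first
   T rounds. *)
Definition run_law (nu : cmab) (psi : strategy) (T : nat) :
    probability (T.-tuple (R * m.-tuple R)) R :=
  iid (seed_law psi \x law nu)%E T.

Definition pulls (nu : cmab) (psi : strategy) (S : {set 'I_m}) T
    (w : T.-tuple (R * m.-tuple R)) : R :=
  \sum_(t < T) (played psi (actions nu) (run w) t == S)%:R.

Definition regret r (nu : cmab) (psi : strategy) T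
    (w : T.-tuple (R * m.-tuple R)) : R :=
  \sum_(t < T) gap r nu (played psi (actions nu) (run w) t).

Definition expected_pulls (nu : cmab) (psi : strategy) (S : {set 'I_m})
    (T : nat) : \bar R :=
  'E_(run_law nu psi T)[@pulls nu psi S T]%E.

Definition expected_regret r (nu : cmab) (psi : strategy) (T : nat) : \bar R :=
  'E_(run_law nu psi T)[@regret r nu psi T]%E.

Definition consistent r (psi : strategy) : Prop :=
  forall (nu : cmab) (S : {set 'I_m}), S \in actions nu -> 0 < gap r nu S ->
  forall alpha : R, 0 < alpha <= 1 ->
    (expected_pulls nu psi S T * ((T%:R `^ alpha)^-1)%:E)%E @[T --> \oo]
      --> 0%E.

End Cmab.

(* Main.v *)
Require Import Defs.
From HB Require Import structures.
From mathcomp Require Import all_boot all_order all_algebra perm.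
From mathcomp Require Import all_classical all_reals all_analysis.
From mathcomp Require Import measurable_realfun ring lra zify.

Set Implicit Arguments.
Unset Strict Implicit.
Unset Printing Implicit Defensive.
Import Order.TTheory GRing.Theory Num.Theory.
Import numFieldNormedType.Exports.
Local Open Scope classical_set_scope.
Local Open Scope ring_scope.

(* The levels of a threshold model, in which the i-th arm pays 1 when the
   level is at most i, carry Bernoulli arms with sorted means p and
   covariances p_i (1 - p_j) for i <= j. The score f = sum_i D_i (X_i - p_i),
   with D the gradient of r at p, therefore has variance gamma~_g^2(mu; I),
   and reweighting the levels by 1 + t f changes the reward by t gamma~_g^2 +
   o(t). In the bad instance the arms of J are deterministic, the optimal
   action has t = 0, and each of the n = (m - K) / K_I other actions has an
   independent copy of the levels reweighted with t = - e, e ~ Delta /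
   gamma~_g^2. Reweighting a single such action with t = d > 0 makes it the
   only optimal one; consistency then forces it to be played at least ln T /
   (4 kappa) times for large T, where kappa = 2 Delta^2 / gamma~_g^2 bounds
   the divergence between the two laws. The constant 8 of the bound leaves
   enough room for crude estimates. When the bound is not positive, an
   instance with two actions and deterministic arms suffices.

   The change of measure is carried out for fixed seeds, where all
   expectations are finite sums, by induction on the horizon. *)

(** * Finite distributions and their products *)

Record fdist (R : realType) (L : finType) := Fdist {
  weight :> L -> R ;
  weight_ge0 : forall l, 0 <= weight l ;
  weight_sum1 : \sum_l weight l = 1 }.

Section ProductFdist.
Context (R : realType) (L : finType) (n : nat).

Lemma prod_weight_ge0 (q : 'I_n -> fdist R L) (w : {ffun 'I_n -> L}) :
  0 <= \prod_a q a (w a).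
Proof. by apply: prodr_ge0 => a _; exact: weight_ge0. Qed.

Lemma prod_weight_sum1 (q : 'I_n -> fdist R L) :
  \sum_(w : {ffun 'I_n -> L}) \prod_a q a (w a) = 1.
Proof.
rewrite -(bigA_distr_bigA (fun a l => q a l)) big1 // => a _.
exact: weight_sum1.
Qed.

Definition prod_fdist (q : 'I_n -> fdist R L) : fdist R {ffun 'I_n -> L} :=
  Fdist (prod_weight_ge0 q) (prod_weight_sum1 q).

(** [phi] is absorbed into the factor of index [b]; the sum over functions then factors, and every
    other factor sums to 1. *)
Lemma prod_fdist_marginal (q : 'I_n -> fdist R L) (b : 'I_n) (phi : L -> R) :
  \sum_w prod_fdist q w * phi (w b) = \sum_l q b l * phi l.
Proof.
pose F a l := q a l * (if a == b then phi l else 1).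
transitivity (\sum_(w : {ffun 'I_n -> L}) \prod_a F a (w a)).
  apply: eq_bigr => w _; rewrite big_split /=; congr (_ * _).
  by rewrite (bigD1 b) //= eqxx big1 ?mulr1 // => a /negbTE ->.
rewrite -(bigA_distr_bigA F) (bigD1 b) //= [X in _ * X]big1 ?mulr1.
  by apply: eq_bigr => l _; rewrite /F eqxx.
move=> a /negbTE ab; rewrite -[RHS](weight_sum1 (q a)).
by apply: eq_bigr => l _; rewrite /F ab mulr1.
Qed.

End ProductFdist.

(** * Finitely supported probability measures *)

Section FiniteLaw.
Local Open Scope ereal_scope.
Context d (T : measurableType d) (R : realType) (L : finType).
Variables (q : fdist R L) (X : L -> T).

(** [msum] takes a sequence of measures indexed by natural numbers; indices beyond the enumeration
    of [L] get the zero measure. *)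
Let atom (i : nat) : {measure set T -> \bar R} :=
  if onth (enum L) i is Some l
  then mscale (NngNum (weight_ge0 q l)) (dirac (X l)) else mzero.

Definition finite_law : set T -> \bar R := msum atom #|L|.

HB.instance Definition _ := Measure.on finite_law.

Lemma sum_atoms (F : option L -> \bar R) :
  \sum_(i < #|L|) F (onth (enum L) i) = \sum_l F (Some l).
Proof.
transitivity (\sum_(l <- enum L) F (Some l)); last by rewrite big_enum.
rewrite cardE; elim: (enum L) => [|l s ih] /=; first by rewrite big_ord0 big_nil.
by rewrite big_ord_recl big_cons /= ih.
Qed.

Lemma finite_lawE A : finite_law A = \sum_l (q l)%:E * \d_(X l) A.
Proof.
pose F o := if o is Some l then (q l)%:E * \d_(X l) A else 0.
rewrite -(sum_atoms F) /finite_law /msum; apply: eq_bigr => i _.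
by rewrite /atom /F; case: onth.
Qed.

Lemma finite_law_setT : finite_law setT = 1.
Proof.
rewrite finite_lawE -[RHS]/((1%R)%:E) -(weight_sum1 q) -sumEFin.
by apply: eq_bigr => l _; rewrite diracT mule1.
Qed.

HB.instance Definition _ :=
  Measure_isProbability.Build _ _ _ finite_law finite_law_setT.

Lemma integral_finite_law (f : T -> \bar R) :
  measurable_fun setT f -> (forall x, 0 <= f x) ->
  \int[finite_law]_x f x = \sum_l (q l)%:E * f (X l).
Proof.
move=> mf f0; pose F o := if o is Some l then (q l)%:E * f (X l) else 0.
rewrite -(sum_atoms F) ge0_integral_measure_sum //; apply: eq_bigr => i _.
rewrite /atom /F; case: onth => [l|]; last by rewrite integral_measure_zero.
by rewrite ge0_integral_mscale //= integral_dirac // diracT mul1e.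
Qed.

Lemma finite_law_full A : (forall l, A (X l)) -> finite_law A = 1.
Proof.
move=> AX; rewrite finite_lawE -[RHS]/((1%R)%:E) -(weight_sum1 q) -sumEFin.
by apply: eq_bigr => l _; rewrite diracE mem_set ?mule1.
Qed.

End FiniteLaw.

(** * Symmetry and directional expansion of the reward *)

Section RewardLemmas.
Context (R : realType) (K : nat).
Implicit Types (r : 'rV[R]_K -> R) (x y v : 'rV[R]_K).

(** [means_on] lists the arms of an action by arm index, the construction below by position;
    symmetry of [r] makes the two orders interchangeable. *)
Lemma reward_perm_eq r x y : smooth_index_invariant r -> cube y ->
  perm_eq [seq x 0 i | i <- enum 'I_K] [seq y 0 i | i <- enum 'I_K] ->
  r x = r y.
Proof.
move=> [_ rC] cy exy.
have : perm_eq [tuple x 0 i | i < K] [tuple y 0 i | i < K] by [].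
move=> /tuple_permP[s es].
have -> : x = col_perm s y; last exact: rC.
apply/rowP => i; rewrite mxE.
have : tnth [tuple x 0 i | i < K] i =
    tnth [tuple tnth [tuple y 0 j | j < K] (s i) | i < K] i.
  by rewrite !(tnth_nth 0) es.
by rewrite !tnth_mktuple.
Qed.

Lemma is_gradient_gradient r x :
  smooth_index_invariant r -> cube x -> is_gradient r x (gradient r x).
Proof. by move=> [rD _] /rD; exact: xgetPex. Qed.

Lemma directional_expansion r x v (g : 'rV[R]_K) (e : R) :
  is_gradient r x g -> 0 < e ->
  exists2 rho : R, 0 < rho & forall t, `|t| <= rho -> cube (x + t *: v) ->
    `|r (x + t *: v) - r x - t * (\sum_i g 0 i * v 0 i)| <= e * `|t|.
Proof.
move=> /eqoP H e0.
(* [|v| + 1] stands in for [|v|], which may vanish; it enters both the error and the radius. *)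
have v1 : 0 < `|v| + 1 by rewrite ltr_wpDl.
have /H : 0 < e / (`|v| + 1) by rewrite divr_gt0.
rewrite near_withinE => /nbhs_ballP[d /= d0 Hd].
exists (d / 2 / (`|v| + 1)); first by rewrite !divr_gt0.
move=> t td ct.
have : `|t| * `|v| < d.
  rewrite ler_pdivlMr// in td.
  apply: le_lt_trans (_ : d / 2 < d); last by lra.
  by apply: le_trans td; rewrite ler_wpM2l//; lra.
rewrite -normrZ => tvd.
have := Hd (x + t *: v); rewrite -ball_normE /= opprD addrA subrr sub0r normrN.
move=> /(_ tvd ct).
rewrite /= [x + _ - x]addrC addKr normrZ.
have -> : \sum_i g 0 i * ((x + t *: v) 0 i - x 0 i) =
    t * \sum_i g 0 i * v 0 i.
  by rewrite mulr_sumr; apply: eq_bigr => i _; rewrite !mxE; ring.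
move=> /le_trans; apply.
rewrite -mulrA ler_wpM2l ?(ltW e0)// mulrC ler_pdivrMr//.
by rewrite ler_wpM2l//; lra.
Qed.

(** The expansion with error 1 at each point of the segment bounds the increment by [|c| + 1] times
    the step, [c] being the directional derivative there. The intermediate value theorem will use
    this to hit a gap exactly. *)
Lemma directional_continuity r x v (a b : R) :
  smooth_index_invariant r ->
  (forall t, a <= t <= b -> cube (x + t *: v)) ->
  {within `[a, b], continuous (fun t => r (x + t *: v))}.
Proof.
move=> hr cx; apply/subspace_continuousP => t /=; rewrite in_itv /= => tab.
have ct := cx t tab.
have [rho rho0 hrho] := @directional_expansion r _ v _ 1
  (is_gradient_gradient hr ct) ltr01.
set c := \sum_i _ in hrho.
have c1 : 0 < `|c| + 1 by rewrite ltr_wpDl.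
apply/cvgrPdist_le => e e0; rewrite near_withinE.
apply/nbhs_ballP; exists (Num.min rho (e / (`|c| + 1))).
  by rewrite /= lt_min rho0 divr_gt0.
move=> u /=; rewrite -ball_normE /= lt_min => /andP[tu1 tu2]; rewrite in_itv/= => uab.
have := hrho (u - t); rewrite distrC (ltW tu1) => /(_ isT).
have -> : x + t *: v + (u - t) *: v = x + u *: v.
  by rewrite -addrA -scalerDl; congr (_ + _ *: _); ring.
move=> /(_ (cx _ uab)); rewrite mul1r => H.
rewrite distrC; apply: (@le_trans _ _ ((`|c| + 1) * `|t - u|)).
  have -> : r (x + u *: v) - r (x + t *: v) =
    (r (x + u *: v) - r (x + t *: v) - (u - t) * c) + (u - t) * c by ring.
  apply: (le_trans (ler_normD _ _)); rewrite normrM [(_ + 1) * _]mulrDl mul1r addrC.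
  by rewrite lerD// 1?mulrC 1?distrC// mulrC.
by rewrite mulrC -ler_pdivlMr// ltW.
Qed.

End RewardLemmas.

(** * The sorted vector p as a permutation of mu *)

Section SortedOutside.
Context (R : realType) (K : nat) (mu : 'rV[R]_K) (I : {set 'I_K}).

(** Sorting positions by their values keeps track of the permutation that sorting the values alone
    would forget. *)
Let sorted_positions : seq 'I_K :=
  sort (relpre (fun i => mu 0 i) <=%R) (enum (~: I)) ++ enum I.

Let size_sorted : size (sort (relpre (fun i => mu 0 i) <=%R) (enum (~: I))) = #|~: I|.
Proof. by rewrite size_sort -cardE. Qed.

Let perm_sorted : perm_eq sorted_positions (enum 'I_K).
Proof.
apply: uniq_perm; rewrite ?enum_uniq//.
  rewrite cat_uniq sort_uniq !enum_uniq andbT /=; apply/hasPn => i.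
  by rewrite mem_sort !mem_enum finset.in_setC negbK.
by move=> i; rewrite mem_cat mem_sort !mem_enum finset.in_setC orNb.
Qed.

Let size_positions : size sorted_positions = K.
Proof. by rewrite (perm_size perm_sorted) size_enum_ord. Qed.

Lemma sorted_outside_perm : exists s : 'S_K,
  (forall j, sorted_outside mu I 0 j = mu 0 (s j)) /\
  (forall j, (s j \in I) = (#|~: I| <= j)%N).
Proof.
pose f (j : 'I_K) := nth j sorted_positions j.
have fE (d j : 'I_K) : f j = nth d sorted_positions j.
  by apply: set_nth_default; rewrite size_positions.
have f_inj : injective f.
  move=> i j; rewrite (fE i i) (fE i j) => /eqP.
  rewrite nth_uniq ?size_positions//; first by move=> /eqP/val_inj.
  by rewrite (perm_uniq perm_sorted) enum_uniq.
exists (perm f_inj); split => j; rewrite permE.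
  rewrite /sorted_outside mxE sort_map -map_cat.
  by rewrite (nth_map j) ?size_positions.
rewrite /f nth_cat size_sorted; case: ltnP => hj.
  have : nth j (sort (relpre (fun i => mu 0 i) <=%R) (enum (~: I))) j \in ~: I.
    by rewrite -mem_enum -(mem_sort (relpre (fun i => mu 0 i) <=%R)) mem_nth ?size_sorted.
  by rewrite finset.in_setC => /negbTE.
rewrite -mem_enum mem_nth// -cardE ltn_subLR//.
by rewrite addnC cardsC card_ord.
Qed.

Lemma sorted_outside_mono (i j : 'I_K) : (i <= j < #|~: I|)%N ->
  sorted_outside mu I 0 i <= sorted_outside mu I 0 j.
Proof.
move=> /andP[ij jk]; rewrite /sorted_outside !mxE.
have szs : size (sort <=%R [seq mu 0 i | i <- enum (~: I)]) = #|~: I|.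
  by rewrite size_sort size_map -cardE.
rewrite !nth_cat szs jk (leq_ltn_trans ij jk).
have := sort_sorted (@le_total _ R) [seq mu 0 i | i <- enum (~: I)].
move=> /(sorted_leq_nth le_trans le_refl 0); apply => //.
- by rewrite inE szs (leq_ltn_trans ij jk).
- by rewrite inE szs.
Qed.

Lemma card_setC_sub : (K - #|I| = #|~: I|)%N.
Proof. by have := cardsC I; rewrite card_ord => {1}<-; rewrite addKn. Qed.

End SortedOutside.

(** * The threshold model and the variance of its score *)

Section ThresholdModel.
Context (R : realType) (K : nat) (p D : 'rV[R]_K) (k : nat).
Hypothesis cp : cube p.
Hypothesis p_mono : forall i j : 'I_K, (i <= j < k)%N -> p 0 i <= p 0 j.

(* Distribution function, shifted by one, of a level l such that
   [l <= j] has probability p j for all j < k. *)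
Definition cumul (l : nat) : R :=
  if l is j.+1 then
    if (insub j : option 'I_K) is Some i then if (i < k)%N then p 0 i else 1
    else 1
  else 0.

Lemma cumulS (j : 'I_K) : (j < k)%N -> cumul j.+1 = p 0 j.
Proof. by move=> jk; rewrite /cumul valK jk. Qed.

Lemma cumul_last : cumul K.+1 = 1.
Proof. by rewrite /cumul insubF ?ltnn. Qed.

Lemma cumul_mono l : cumul l <= cumul l.+1.
Proof.
case: l => [|j] /=.
  case: insubP => // i _ _; case: ifP => // _.
  by have /andP[] := cp i.
case: insubP => [i1 _ i1j|jK]; case: insubP => [i2 _ i2j|_] //; last first.
- by have := ltn_ord i2; rewrite i2j => /ltnW; rewrite (negbTE jK).
- by case: ifP => // _; have /andP[] := cp i1.
case: ifP => i1k; case: ifP => // i2k.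
- by apply: p_mono; rewrite i2k andbT; move: i1j i2j => /= -> ->.
- by have /andP[] := cp i1.
- by exfalso; move: i1j i2j i1k i2k => /= -> ->; lia.
Qed.

Lemma level_weight_ge0 (l : 'I_K.+1) : 0 <= cumul l.+1 - cumul l.
Proof. by rewrite subr_ge0 cumul_mono. Qed.

Lemma level_weight_sum1 : \sum_(l < K.+1) (cumul l.+1 - cumul l) = 1.
Proof.
rewrite -(big_mkord xpredT (fun l => cumul l.+1 - cumul l)).
by rewrite telescope_sumr// cumul_last subr0.
Qed.

Definition level_fdist : fdist R 'I_K.+1 :=
  Fdist level_weight_ge0 level_weight_sum1.
Arguments level_fdist : simpl never.

Lemma level_fdist_le (j : 'I_K) : (j < k)%N ->
  \sum_l level_fdist l * (l <= j)%:R = p 0 j.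
Proof.
move=> jk; rewrite -cumulS// -[RHS]subr0 -[X in _ - X]/(cumul 0).
rewrite -(telescope_sumr _ (leq0n j.+1)) big_mkord.
rewrite (big_ord_widen K.+1 (fun l => cumul l.+1 - cumul l)); last first.
  by rewrite ltnS ltnW.
rewrite [RHS]big_mkcond; apply: eq_bigr => l _ /=.
by rewrite ltnS; case: leqP; rewrite ?mulr1 ?mulr0.
Qed.

Definition score (l : 'I_K.+1) : R :=
  \sum_(j < K | (j < k)%N) D 0 j * ((l <= j)%:R - p 0 j).

(** Covariances of the score with the arms, uncentred because the score has mean zero. They are the
    velocities of the arm means under tilting by the score; the arms at positions from [k] on will
    be deterministic, hence the zeros. *)
Definition score_cov : 'rV[R]_K :=
  \row_j (if (j < k)%N then \sum_l level_fdist l * (score l * (l <= j)%:R) else 0).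

Lemma score_mean : \sum_l level_fdist l * score l = 0.
Proof.
under eq_bigr do rewrite mulr_sumr.
rewrite exchange_big big1// => j jk.
transitivity (D 0 j * (\sum_l level_fdist l * (l <= j)%:R
    - p 0 j * \sum_l level_fdist l)).
  by rewrite mulr_sumr -sumrB mulr_sumr; apply: eq_bigr => l _; ring.
by rewrite level_fdist_le// weight_sum1 mulr1 subrr mulr0.
Qed.

(** The score is the combination of the centred arms with coefficients [D], so its variance is the
    same combination of its covariances. When [D] is the gradient of the reward, the left side is
    the slope of the reward along [score_cov]. *)
Lemma score_cov_dot :
  \sum_j D 0 j * score_cov 0 j = \sum_l level_fdist l * score l ^+ 2.
Proof.
transitivity (\sum_(j < K | (j < k)%N)
    \sum_l level_fdist l * (score l * (D 0 j * ((l <= j)%:R - p 0 j)))).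
  rewrite [RHS]big_mkcond; apply: eq_bigr => j _; rewrite mxE.
  case: ifP => jk; last by rewrite mulr0.
  transitivity (\sum_l level_fdist l * (score l * (D 0 j * (l <= j)%:R)) -
      D 0 j * p 0 j * \sum_l level_fdist l * score l).
    rewrite score_mean mulr0 subr0 mulr_sumr.
    by apply: eq_bigr => l _; ring.
  by rewrite mulr_sumr -sumrB; apply: eq_bigr => l _; ring.
rewrite exchange_big; apply: eq_bigr => l _.
by rewrite -mulr_sumr -mulr_sumr expr2.
Qed.

Lemma sum_symmetric (c : 'I_K -> 'I_K -> R) :
  (forall i j, c i j = c j i) ->
  \sum_(i < K | (i < k)%N) \sum_(j < K | (j < k)%N) c i j =
  \sum_(i < K | (i < k)%N) c i i +
  2 * \sum_(i < K | (i < k)%N) \sum_(j < K | (i < j < k)%N) c i j.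
Proof.
move=> c_sym.
have split3 (i : 'I_K) : (i < k)%N -> \sum_(j < K | (j < k)%N) c i j =
    c i i + \sum_(j < K | (i < j < k)%N) c i j
    + \sum_(j < K | (j < i)%N && (j < k)%N) c i j.
  move=> ik; rewrite (bigD1 i)//= -addrA; congr (_ + _).
  rewrite (bigID (fun j : 'I_K => (i < j)%N))/=; congr (_ + _); apply: eq_bigl => j.
    by rewrite -(inj_eq val_inj) /=; lia.
  by rewrite -(inj_eq val_inj) /=; lia.
rewrite (eq_bigr _ split3) !big_split/= -addrA mulr_natl mulr2n; congr (_ + (_ + _)).
rewrite (exchange_big_dep (fun i : 'I_K => (i < k)%N))/=; last by move=> i j _ /andP[].
apply: eq_bigr => j jk; apply: eq_big => i; first by lia.
by move=> _; exact: c_sym.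
Qed.

Lemma score_variance : \sum_l level_fdist l * score l ^+ 2 =
  \sum_(i < K | (i < k)%N) p 0 i * (1 - p 0 i) * D 0 i ^+ 2 +
  2 * \sum_(i < K | (i < k)%N) \sum_(j < K | (i < j < k)%N)
        p 0 i * (1 - p 0 j) * D 0 i * D 0 j.
Proof.
pose c (i j : 'I_K) := \sum_l level_fdist l *
  (D 0 i * ((l <= i)%:R - p 0 i) * (D 0 j * ((l <= j)%:R - p 0 j))).
have c_sym i j : c i j = c j i by apply: eq_bigr => l _; ring.
have cE (i j : 'I_K) : (i <= j < k)%N -> c i j = p 0 i * (1 - p 0 j) * D 0 i * D 0 j.
  move=> /andP[ij jk]; have ik := leq_ltn_trans ij jk.
  transitivity (D 0 i * D 0 j * (\sum_l level_fdist l * (l <= i)%:R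
    - p 0 j * (\sum_l level_fdist l * (l <= i)%:R)
    - p 0 i * (\sum_l level_fdist l * (l <= j)%:R)
    + p 0 i * p 0 j * \sum_l level_fdist l)).
    rewrite !mulr_sumr -!sumrB -big_split mulr_sumr; apply: eq_bigr => l _.
    (* The events [l <= i] and [l <= j] are nested, whence the covariance p_i - p_i p_j. *)
    have ab : (l <= i)%:R * (l <= j)%:R = (l <= i)%:R :> R.
      by have [li|] := leqP l i; rewrite ?mul0r// (leq_trans li ij) mulr1.
    move: ((l <= i)%:R) ((l <= j)%:R) ab => a b ab.
    transitivity (level_fdist l * D 0 i * D 0 j *
      (a * b - p 0 j * a - p 0 i * b + p 0 i * p 0 j)); first by ring.
    by rewrite ab /=; ring.
  by rewrite !level_fdist_le// weight_sum1; ring.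
transitivity (\sum_(i < K | (i < k)%N) \sum_(j < K | (j < k)%N) c i j).
  under eq_bigr do rewrite /score expr2 mulr_suml mulr_sumr.
  rewrite exchange_big; apply: eq_bigr => i _.
  under eq_bigr do rewrite mulr_sumr mulr_sumr.
  by rewrite exchange_big.
rewrite sum_symmetric//; congr (_ + 2 * _).
  by apply: eq_bigr => i ik; rewrite cE ?leqnn//; ring.
by apply: eq_bigr => i ik; apply: eq_bigr => j /andP[ij jk]; rewrite cE// ltnW.
Qed.

End ThresholdModel.

(** This serves for arm rewards, which are nonnegative at the atoms but not on the whole space: the
    negative part vanishes at every atom. *)
Lemma integral_finite_law_support d (T : measurableType d) (R : realType)
    (L : finType) (q : fdist R L) (X : L -> T) (f : T -> \bar R) :
  measurable_fun setT f -> (forall l, 0 <= f (X l))%E ->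
  (\int[finite_law q X]_x f x = \sum_l (q l)%:E * f (X l))%E.
Proof.
move=> mf f0; rewrite integralE !integral_finite_law//; last 2 first.
- exact: measurable_funeneg.
- exact: measurable_funepos.
rewrite [X in (_ - X)%E]big1 ?sube0; last first.
  by move=> l _; rewrite funenegE max_r ?mule0// oppe_le0.
by apply: eq_bigr => l _; rewrite funeposE max_l.
Qed.

(** * Placement of the actions among the arms *)

Section SlotAssignment.
Context (m K n : nat) (I : {set 'I_K}).
Hypothesis room : (K + n * #|~: I| <= m)%N.

(* Action 0 occupies the first K arms and lends those at positions in I to all the
   others; the remaining arms of action a > 0 form the a-th block after them. *)
Definition slot_nat (a : 'I_n.+1) (i : 'I_K) : nat :=
  if (a == ord0) || (i \in I) then (i : nat)
  else (K + (a.-1 * #|~: I| + index i (enum (~: I))))%N.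

Lemma index_lt (i : 'I_K) : i \notin I -> (index i (enum (~: I)) < #|~: I|)%N.
Proof. by move=> iI; rewrite cardE index_mem mem_enum finset.in_setC. Qed.

Lemma slot_lt a i : (slot_nat a i < m)%N.
Proof.
rewrite /slot_nat; case: ifPn => [_|].
  exact: leq_trans (ltn_ord i) (leq_trans (leq_addr _ _) room).
rewrite negb_or => /andP[a0 iI]; apply: leq_trans room.
rewrite ltn_add2l -addnS; apply: leq_trans (leq_add (leqnn _) (index_lt iI)) _.
rewrite addnC -mulSn leq_mul2r; apply/orP; right.
by rewrite prednK ?lt0n// -ltnS.
Qed.

Definition slot a i : 'I_m := Ordinal (slot_lt a i).

(** An arm below [K] is its own position; for the others, division with remainder by [#|~: I|]
    recovers the action and the position in its block. *)
Lemma slot_eq a b i j : slot a i = slot b j -> i = j /\ (a = b \/ i \in I).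
Proof.
move=> /(congr1 val)/=; rewrite /slot_nat.
case: ifPn => [ai|]; case: ifPn => [bj|].
- move=> /val_inj ij; split => //; subst j.
  case/orP: ai => [/eqP a0|]; last by right.
  by case/orP: bj => [/eqP ->|]; [left|right].
- by move=> _ e; have := ltn_ord i; rewrite e ltnNge leq_addr.
- by move=> _ e; have := ltn_ord j; rewrite -e ltnNge leq_addr.
rewrite !negb_or => /andP[b0 jI] /andP[a0 iI] /addnI e.
have k0 : (0 < #|~: I|)%N by apply: leq_trans (index_lt iI).
have := congr1 (divn^~ #|~: I|) e; have := congr1 (modn^~ #|~: I|) e.
rewrite !modnMDl !modn_small ?index_lt// !divnMDl// !divn_small ?index_lt// !addn0.
move=> eidx eab; split.
  have := congr1 (nth i (enum (~: I))) eidx.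
  by rewrite !nth_index ?mem_enum ?finset.in_setC.
by left; apply/val_inj; move: a0 b0 eab; rewrite -!(inj_eq val_inj) /=; lia.
Qed.

Lemma slot_inj a : injective (slot a).
Proof. by move=> i j /slot_eq[]. Qed.

Lemma slot_shared a b i : i \in I -> slot a i = slot b i.
Proof. by move=> iI; apply/val_inj; rewrite /= /slot_nat iI !orbT. Qed.

Definition action (a : 'I_n.+1) : {set 'I_m} := [set slot a i | i : 'I_K]%SET.

Definition shared : {set 'I_m} := [set slot ord0 i | i in I]%SET.

Definition all_actions : {set {set 'I_m}} := [set action a | a : 'I_n.+1]%SET.

Lemma card_action a : #|action a| = K.
Proof. by rewrite card_imset ?card_ord//; exact: slot_inj. Qed.

Lemma action_in a : action a \in all_actions.
Proof. exact: imset_f. Qed.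

Lemma all_actionsP : action_set K all_actions.
Proof.
split; first by apply/finset.set0Pn; exists (action ord0); exact: action_in.
by move=> S /finset.imsetP[a _ ->]; exact: card_action.
Qed.

Lemma action_capE a b : a != b -> action a :&: action b = shared.
Proof.
move=> ab; apply/finset.setP => j; rewrite finset.in_setI; apply/andP/finset.imsetP.
  move=> [/finset.imsetP[i _ ->] /finset.imsetP[i' _ /slot_eq[_ [/eqP|iI]]]].
    by rewrite (negbTE ab).
  by exists i => //; exact: slot_shared.
move=> [i iI ->]; split; apply/finset.imsetP; exists i => //; exact: slot_shared.
Qed.

Lemma card_shared : (#|shared| <= K)%N.
Proof.
apply: leq_trans (leq_imset_card _ _) _.
by rewrite -[X in (_ <= X)%N](card_ord K) max_card.
Qed.

(** A position outside [I] yields an arm that lies in one action only. *)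
Lemma action_inj : I != [set: 'I_K]%SET -> injective action.
Proof.
move=> IT a b ab; have [i iI] : exists i, i \notin I.
  apply/existsP; apply: contraNT IT; rewrite negb_exists => /forallP iI.
  by apply/eqP/finset.setP => i; rewrite finset.in_setT; have := iI i; rewrite negbK.
have : slot a i \in action b by rewrite -ab imset_f.
by move=> /finset.imsetP[j _ /slot_eq[_ [//|]]]; rewrite (negbTE iI).
Qed.

(** The slots of action 0 increase with the position, so its mean vector will be [mu] itself and not
    only a rearrangement. *)
Lemma enum_action0 : enum (action ord0) = [seq slot ord0 i | i <- enum 'I_K].
Proof.
have srt p : sorted (relpre val ltn) (enum 'I_p).
  by rewrite -sorted_map val_enum_ord iota_ltn_sorted.
apply: (@irr_sorted_eq _ (relpre val ltn)).
- by move=> x y z /=; exact: ltn_trans.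
- by move=> x /=; exact: ltnn.
- rewrite {1}/enum_mem; apply: sorted_filter; first by move=> x y z /=; exact: ltn_trans.
  by have := srt m; rewrite enumT.
- rewrite sorted_map (@eq_sorted _ _ (relpre val ltn))//.
- move=> j; rewrite mem_enum; apply/finset.imsetP/mapP => -[i _ ->]; exists i => //.
  by rewrite mem_enum.
Qed.

End SlotAssignment.

(** * Problems with one independent level per action *)

Section Problem.
Context (R : realType) (m K n : nat) (I : {set 'I_K}).
Hypothesis room : (K + n * #|~: I| <= m)%N.
Context (L : finType) (value : L -> 'rV[R]_K).
Hypothesis value_cube : forall l, cube (value l).
Hypothesis value_shared :
  forall i, i \in I -> forall l l', value l 0 i = value l' 0 i.

Local Notation slot := (slot room).
Local Notation action := (action room).
Local Notation shared := (shared room).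
Local Notation arm_laws := ('I_n.+1 -> fdist R L).
Implicit Types (q : arm_laws) (w : {ffun 'I_n.+1 -> L}).

(** Several slots may be the same shared arm; which one is picked is immaterial by [value_shared].
    Arms outside every action are constantly 0. *)
Definition arm_value w (j : 'I_m) : R :=
  if [pick ai : 'I_n.+1 * 'I_K | slot ai.1 ai.2 == j] is Some ai
  then value (w ai.1) 0 ai.2 else 0.

Definition arms w : m.-tuple R := [tuple arm_value w j | j < m].

Lemma arm_value_slot w a i : arm_value w (slot a i) = value (w a) 0 i.
Proof.
rewrite /arm_value; case: pickP => [[b j] /= /eqP|/(_ (a, i))]; last by rewrite eqxx.
move=> /slot_eq[<- [<-//|jI]]; exact: value_shared.
Qed.

Lemma arm_value_cube w j : 0 <= arm_value w j <= 1.
Proof.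
rewrite /arm_value; case: pickP => [[b i] _|_]; first exact: value_cube.
by rewrite lexx ler01.
Qed.

Lemma problem_support q :
  finite_law (prod_fdist q) arms [set x | forall i, 0 <= tnth x i <= 1] = 1%E.
Proof.
apply: finite_law_full => w i; rewrite tnth_mktuple; exact: arm_value_cube.
Qed.

Definition problem q : cmab R m K :=
  Cmab (all_actionsP room) (problem_support q).

Definition action_means q (a : 'I_n.+1) : 'rV[R]_K :=
  \row_i \sum_l q a l * value l 0 i.

Lemma action_means_cube q a : cube (action_means q a).
Proof.
move=> i; rewrite mxE; apply/andP; split.
  by apply: sumr_ge0 => l _; rewrite mulr_ge0 ?weight_ge0//; have /andP[] := value_cube l i.
rewrite -(weight_sum1 (q a)); apply: ler_sum => l _.
by rewrite ler_piMr ?weight_ge0//; have /andP[] := value_cube l i.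
Qed.

Lemma arm_mean_slot q a i : arm_mean (problem q) (slot a i) = action_means q a 0 i.
Proof.
rewrite /arm_mean expectation.unlock /= integral_finite_law_support; last 2 first.
- by apply/measurable_EFinP; exact: measurable_tnth.
- by move=> w; rewrite lee_fin tnth_mktuple; have /andP[] := arm_value_cube w (slot a i).
under eq_bigr do rewrite tnth_mktuple arm_value_slot -EFinM.
rewrite sumEFin /= mxE.
exact: (prod_fdist_marginal q a (fun l => value l 0 i)).
Qed.

Lemma means_on_entries (nu : cmab R m K) (S : {set 'I_m}) : #|S| = K ->
  [seq means_on nu S 0 k | k <- enum 'I_K] = [seq arm_mean nu i | i <- enum S].
Proof.
move=> SK; apply: (@eq_from_nth _ 0).
  by rewrite [LHS]size_map [RHS]size_map size_enum_ord -cardE.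
move=> k; rewrite size_map size_enum_ord => kK.
rewrite (nth_map (Ordinal kK)) ?size_enum_ord// mxE; congr nth.
by rewrite nth_enum_ord.
Qed.

Lemma reward_action r q a : smooth_index_invariant r ->
  r (means_on (problem q) (action a)) = r (action_means q a).
Proof.
move=> hr; apply: reward_perm_eq => //; first exact: action_means_cube.
rewrite means_on_entries ?card_action//.
have -> : [seq action_means q a 0 i | i <- enum 'I_K] =
    [seq arm_mean (problem q) j | j <- [seq slot a i | i <- enum 'I_K]].
  by rewrite -map_comp; apply: eq_map => i /=; rewrite arm_mean_slot.
apply: perm_map; apply: uniq_perm; rewrite ?enum_uniq//.
  by rewrite map_inj_uniq ?enum_uniq//; exact: slot_inj.
move=> j; rewrite mem_enum; apply/finset.imsetP/mapP => -[i _ ->]; exists i => //.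
by rewrite mem_enum.
Qed.

Lemma means_on_action0 q : means_on (problem q) (action ord0) = action_means q ord0.
Proof.
apply/rowP => k; rewrite [LHS]mxE enum_action0 -map_comp.
rewrite (nth_map k) ?size_enum_ord// nth_ord_enum /=; exact: arm_mean_slot.
Qed.

Lemma problem_disjoint q : disjoint_over shared (problem q).
Proof.
split; first exact: card_shared.
- move=> A B _ _.
  (* The arms of [shared] are deterministic, so every event about them has probability 0 or 1 and
     independence follows. *)
  have const_block w w' : block shared (arms w) = block shared (arms w').
    apply: eq_from_tnth => j; rewrite !tnth_mktuple.
    case: ifP => // /finset.imsetP[i iI ->].
    by rewrite ?tnth_mktuple !arm_value_slot; exact: value_shared.
  have [[w Aw]|NA] := pselect (exists w, A (block shared (arms w))).
    have AX w' : (block shared @^-1` A) (arms w') by rewrite /preimage /= (const_block w' w).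
    rewrite /= (finite_law_full _ AX) mul1e !finite_lawE; apply: eq_bigr => w' _.
    by rewrite !diracE; congr (_ * (_ : bool)%:R%:E)%E; rewrite in_setI mem_set.
  have NAX w' : ~ (block shared @^-1` A) (arms w') by move=> Aw'; apply: NA; exists w'.
  rewrite /= !finite_lawE big1 => [|w' _].
    rewrite big1 ?mul0e// => w' _.
    by rewrite diracE memNset ?mule0.
  by rewrite diracE memNset ?mule0// => -[/NAX].
- move=> _ _ /finset.imsetP[a _ ->] /finset.imsetP[b _ ->] ab; apply: action_capE.
  by apply: contraNneq ab => ->.
Qed.

Lemma feedback_action w a : feedback (action a) (arms w) =
  feedback (action a) (arms [ffun=> w a]).
Proof.
apply: eq_from_tnth => j; rewrite !tnth_mktuple; case: ifP => // /finset.imsetP[i _ ->].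
by rewrite ?tnth_mktuple !arm_value_slot ffunE.
Qed.

(** The feedback of an action is a function of its own level, the shared arms being deterministic,
    so only the marginal at [a] matters. Hence only plays of an action whose law is modified carry
    information on the modification. *)
Lemma sum_feedback q q' a (phi : m.-tuple (bool * R) -> R) :
  q a =1 q' a ->
  \sum_w prod_fdist q w * phi (feedback (action a) (arms w)) =
  \sum_w prod_fdist q' w * phi (feedback (action a) (arms w)).
Proof.
move=> qq'; pose psi l := phi (feedback (action a) (arms [ffun=> l])).
have E (p : arm_laws) : \sum_w prod_fdist p w * phi (feedback (action a) (arms w)) =
    \sum_l p a l * psi l.
  by rewrite -prod_fdist_marginal; apply: eq_bigr => w _; rewrite feedback_action.
by rewrite !E; apply: eq_bigr => l _; rewrite qq'.
Qed.

Lemma gap_action r q a (b : 'I_n.+1) : smooth_index_invariant r ->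
  (forall c, r (action_means q c) <= r (action_means q b)) ->
  gap r (problem q) (action a) = r (action_means q b) - r (action_means q a).
Proof.
move=> hr hb; rewrite /gap !reward_action//; congr (_ - _).
apply/eqP; rewrite eq_le; apply/andP; split.
  apply: bigmax_le; first exact: hb.
  by move=> _ /finset.imsetP[c _ ->]; rewrite reward_action.
rewrite -(reward_action q b hr).
apply: (@le_bigmax_cond _ _ _ _ (action b) _ (fun S => r (means_on (problem q) S))).
exact: action_in.
Qed.

Lemma problem_optimal r q : smooth_index_invariant r ->
  (forall c, r (action_means q c) <= r (action_means q ord0)) ->
  optimal r (problem q) (action ord0).
Proof.
move=> hr h0; split; first exact: action_in.
by move=> _ /finset.imsetP[a _ ->]; rewrite !reward_action.
Qed.

Lemma problem_minimal_gap r q (Delta : R) : smooth_index_invariant r ->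
  (0 < n)%N -> 0 < Delta ->
  (forall a, a != ord0 -> r (action_means q a) = r (action_means q ord0) - Delta) ->
  minimal_gap r (problem q) = Delta%:E.
Proof.
move=> hr n0 D0 hq.
have h0 c : r (action_means q c) <= r (action_means q ord0).
  by have [->//|/hq ->] := eqVneq c ord0; rewrite gerBl ltW.
have gE a : gap r (problem q) (action a) = if a == ord0 then 0 else Delta.
  by rewrite (gap_action a hr h0); case: eqVneq => [->|/hq ->]; [exact: subrr|ring].
rewrite /minimal_gap; apply/eqP; rewrite eq_le; apply/andP; split.
  have a1 : lift ord0 (Ordinal n0) != ord0 by rewrite eq_sym neq_lift.
  have := gE (lift ord0 (Ordinal n0)); rewrite (negbTE a1) => e.
  rewrite -e; apply: (@bigmin_le_cond _ _ _ +oo%E (action (lift ord0 (Ordinal n0))) _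
    (fun S => (gap r (problem q) S)%:E)).
  by rewrite action_in e.
apply: le_bigmin; first exact: leey.
move=> _ /andP[/finset.imsetP[a _ ->]]; rewrite gE lee_fin.
by case: ifP; rewrite ?ltxx.
Qed.

End Problem.

(** * Expectations over finite laws for fixed seeds *)

Section FiniteExpectation.
Context (R : realType) (U V : Type) (L : finType).
Implicit Types (q : L -> R) (X : L -> V) (us : seq U) (phi psi : seq (U * V) -> R).

(* Expectation of phi (zip us vs), where vs is a vector of independent draws of
   X with weights q. *)
Fixpoint fexp q X us phi : R :=
  if us is u :: us' then \sum_l q l * fexp q X us' (fun w => phi ((u, X l) :: w))
  else phi [::].

Lemma eq_fexp q X us phi psi : phi =1 psi -> fexp q X us phi = fexp q X us psi.
Proof.
elim: us phi psi => [|u us ih] phi psi e /=; first exact: e.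
by apply: eq_bigr => l _; congr (_ * _); apply: ih => w.
Qed.

Lemma fexpZ q X us a phi : fexp q X us (fun w => a * phi w) = a * fexp q X us phi.
Proof.
elim: us phi => [|u us ih] phi //=; rewrite mulr_sumr.
by apply: eq_bigr => l _; rewrite ih mulrCA.
Qed.

Lemma fexpD q X us phi psi :
  fexp q X us (fun w => phi w + psi w) = fexp q X us phi + fexp q X us psi.
Proof.
elim: us phi psi => [|u us ih] phi psi //=; rewrite -big_split /=.
by apply: eq_bigr => l _; rewrite ih mulrDr.
Qed.

Lemma fexp_cst (q : fdist R L) X us a : fexp q X us (fun=> a) = a.
Proof.
elim: us => [|u us ih] //=; under eq_bigr do rewrite ih.
by rewrite -mulr_suml weight_sum1 mul1r.
Qed.

Lemma le_fexp (q : fdist R L) X us phi psi :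
  (forall w, size w = size us -> phi w <= psi w) ->
  fexp q X us phi <= fexp q X us psi.
Proof.
elim: us phi psi => [|u us ih] phi psi le_pp /=; first exact: le_pp.
apply: ler_sum => l _; rewrite ler_wpM2l ?weight_ge0//.
by apply: ih => w sw; apply: le_pp; rewrite /= sw.
Qed.

End FiniteExpectation.

(** * Counting pulls along a run *)

Section PullCount.
Context (R : realType) (m K : nat).
Variables (psi : strategy R m K) (A : {set {set 'I_m}}).

(** The history is a plain sequence whose length gives the round; this spares the later inductions
    the casts between tuple types. *)
Definition next_action (h : seq (R * m.-tuple (bool * R))) (u : R) : {set 'I_m} :=
  Defs.choose psi A (in_tuple h, u).

Lemma chooseE t (h : t.-tuple (R * m.-tuple (bool * R))) u :
  Defs.choose psi A (h, u) = next_action h u.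
Proof.
rewrite /next_action; case: h => s e /=; move: (e); move/eqP: (e) => es.
by case: _ / es => e'; congr (Defs.choose psi A (_, u)); exact: val_inj.
Qed.

Fixpoint pull_count (S : {set 'I_m}) (h : seq (R * m.-tuple (bool * R)))
    (w : seq (R * m.-tuple R)) : nat :=
  if w is (u, x) :: w' then
    ((next_action h u == S) +
     pull_count S (rcons h (u, feedback (next_action h u) x)) w')%N
  else 0%N.

(** The starting round [s] is arbitrary so that the induction on the horizon can advance it. *)
Lemma pull_count_history S (w : nat -> R * m.-tuple R) s T :
  (\sum_(t < T) (played psi A w (s + t) == S)%N)%N =
  pull_count S (history psi A w s) (mkseq (fun t => w (s + t)%N) T).
Proof.
elim: T s => [|T ih] s; first by rewrite big_ord0.
rewrite big_ord_recl addn0 /mkseq /= addn0 (surjective_pairing (w s)) /=.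
rewrite {1}/played chooseE; congr addn.
rewrite (_ : rcons _ _ = history psi A w s.+1); last by rewrite /= chooseE.
rewrite (iotaDl 1 0) -map_comp.
under eq_bigr do rewrite /= /bump leq0n addnA addn1.
by rewrite ih; congr pull_count; apply: eq_map => t /=; rewrite addnA addn1.
Qed.

Lemma pullsE (nu : cmab R m K) S T (w : T.-tuple (R * m.-tuple R)) :
  A = actions nu -> pulls nu psi S w = (pull_count S [::] w)%:R.
Proof.
move=> eA; rewrite /pulls -natr_sum -eA; congr (_%:R).
rewrite (pull_count_history S (run w) 0 T); congr pull_count.
by rewrite -[RHS](mkseq_nth (0, [tuple of nseq m 0])) (size_tuple w).
Qed.

Lemma pull_count_le S h w : (pull_count S h w <= size w)%N.
Proof.
elim: w h => [|[u x] w ih] h //=.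
by rewrite -[X in (_ <= X)%N]add1n leq_add// leq_b1.
Qed.

End PullCount.

(** * Change of measure between two arm laws *)

Section ChangeOfMeasure.
Context (R : realType) (m K : nat).
Variables (psi : strategy R m K) (A : {set {set 'I_m}}).
Hypothesis hA : action_set K A.
Variables (L : finType) (q q' : fdist R L) (X : L -> m.-tuple R).
Variables (Sa : {set 'I_m}) (g : L -> R) (kappa : R).
Hypothesis g0 : forall l, 0 < g l.
Hypothesis q'E : forall l, q' l = g l * q l.
Hypothesis kl_le : - kappa <= \sum_l q l * ln (g l).
Hypothesis other_actions : forall S, S \in A -> S != Sa ->
  forall phi : m.-tuple (bool * R) -> R,
  \sum_l q' l * phi (feedback S (X l)) = \sum_l q l * phi (feedback S (X l)).

(* The constants are those of the tangent line inequality
   [x >= expR c * (1 + ln x - c)] and of [x >= ln x], which bound the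
   likelihood ratio on the events counted by [1 - N / T] and [N / T]. *)
Lemma change_of_measure_step (T : nat) (c : R) us h n l :
  (0 < T)%N -> 0 < l -> (n + size us <= T)%N -> c <= 0 ->
  let N w := pull_count psi A Sa h w in
  expR c * (fexp q X us (fun w => (1 - c) * (1 - (n + N w)%:R / T%:R)
                                 - kappa * (N w)%:R) + ln l) <=
  fexp q' X us (fun w => l * (1 - (n + N w)%:R / T%:R
                              + expR c * ((n + N w)%:R / T%:R))).
Proof.
move=> T0; elim: us h n l => [|u us ih] h n l l0 nT c0 /=.
  rewrite mulr0 subr0 addn0.
  set z := n%:R / T%:R.
  have z0 : 0 <= z by rewrite divr_ge0.
  have z1 : z <= 1.
    by rewrite ler_pdivrMr ?ltr0n// mul1r ler_nat (leq_trans _ nT)// leq_addr.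
  have lnl : ln l <= l - 1.
    have := @expR_ge1Dx R (ln l); rewrite lnK ?posrE//; lra.
  have lnle : expR c * (1 + ln l - c) <= l.
    have := @expR_ge1Dx R (ln l - c); rewrite expRD lnK ?posrE// expRN => H.
    by rewrite mulrC -ler_pdivlMr ?expR_gt0//; lra.
  have e0 := @expR_gt0 R c.
  have h1 : 0 <= (1 - z) * (l - expR c * (1 + ln l - c)).
    by rewrite mulr_ge0// subr_ge0.
  have h2 : 0 <= expR c * z * (l - 1 - ln l).
    by rewrite mulr_ge0// ?mulr_ge0 ?subr_ge0 ?(ltW e0).
  have h3 : 0 <= expR c * z by rewrite mulr_ge0 ?(ltW e0).
  nra.
set S := next_action psi A h u.
pose N' o w := pull_count psi A Sa (rcons h (u, feedback S (X o))) w.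
have SA : S \in A by exact: choose_action.
(* A play of [Sa] multiplies the likelihood ratio [l] by [g] and costs at most [kappa] in expected
   logarithm; any other play leaves [l] unchanged, its feedback having the same law under [q] and
   [q']. *)
have [eS|nS] := eqVneq S Sa.
- rewrite (eq_bigr (fun o => q o * (fexp q X us (fun w =>
     (1 - c) * (1 - (n.+1 + N' o w)%:R / T%:R) - kappa * (N' o w)%:R) - kappa)));
    last first.
    move=> o _; congr (_ * _); rewrite -(fexp_cst q X us (- kappa)) -fexpD.
    by apply: eq_fexp => w; rewrite add1n addSnnS -natr1; ring.
  under [X in _ <= X]eq_bigr => o _ do rewrite q'E [g o * _]mulrC -mulrA -fexpZ.
  have -> : ln l = \sum_o q o * ln l by rewrite -mulr_suml weight_sum1 mul1r.
  apply: (@le_trans _ _ (\sum_o q o * (expR c * (fexp q X us (fun w =>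
     (1 - c) * (1 - (n.+1 + N' o w)%:R / T%:R) - kappa * (N' o w)%:R)
     + ln (l * g o))))).
    under [X in _ <= X]eq_bigr => o _ do rewrite mulrCA lnM ?posrE// addrA.
    rewrite -mulr_sumr ler_wpM2l ?expR_ge0//.
    under eq_bigr => o _ do rewrite mulrDr.
    under [X in _ <= X]eq_bigr => o _ do rewrite mulrDr mulrDr.
    rewrite !big_split/= -!mulr_suml weight_sum1. move: kl_le. lra.
  apply: ler_sum => o _; rewrite ler_wpM2l ?weight_ge0//.
  apply: (le_trans (ih (rcons h (u, feedback S (X o))) n.+1 _ _ _ c0)).
  + by rewrite mulr_gt0.
  + by rewrite addSn -addnS.
  + rewrite le_eqVlt; apply/orP; left; apply/eqP; apply: eq_fexp => w.
    by rewrite add1n addSnnS; ring.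
- under eq_bigr => o _ do under eq_fexp => w do rewrite add0n.
  under [X in _ <= X]eq_bigr => o _ do under eq_fexp => w do rewrite add0n.
  rewrite (other_actions SA nS (fun y => fexp q' X us (fun w =>
    l * (1 - (n + pull_count psi A Sa (rcons h (u, y)) w)%:R / T%:R
         + expR c * ((n + pull_count psi A Sa (rcons h (u, y)) w)%:R / T%:R))))).
  have -> : ln l = \sum_o q o * ln l by rewrite -mulr_suml weight_sum1 mul1r.
  rewrite -big_split /= mulr_sumr; apply: ler_sum => o _.
  rewrite -mulrDr mulrCA ler_wpM2l ?weight_ge0//.
  by apply: ih => //; rewrite (leq_trans _ nT)// leq_add2l.
Qed.

(** The induction is started at [c = - C], [l = 1] and multiplied by [expR C]. With [z] the expected
    fraction of plays of [Sa] under [q'], its right side becomes [expR C * (1 - z) + z], and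
    [z <= 1] accounts for the final 1. *)
Lemma change_of_measure (C : R) us :
  (0 < size us)%N -> 0 <= C ->
  let N (w : seq (R * m.-tuple R)) : R := (pull_count psi A Sa [::] w)%:R in
  (1 + C) * (1 - fexp q X us N / (size us)%:R) <=
  kappa * fexp q X us N + expR C * (1 - fexp q' X us N / (size us)%:R) + 1.
Proof.
move=> T0 C0; cbv zeta; set N := (fun w => _%:R); set T := size us in T0 *.
have c0 : - C <= 0 by rewrite oppr_le0.
have := @change_of_measure_step T (- C) us [::] 0%N 1 T0 ltr01 (leqnn _) c0.
rewrite /= ln1 addr0 opprK.
have lin (p : fdist R L) a b :
    fexp p X us (fun w => a + b * N w) = a + b * fexp p X us N.
  by rewrite fexpD fexp_cst fexpZ.
rewrite (@eq_fexp _ _ _ _ q X us _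
    (fun w => (1 + C) + (- (1 + C) / T%:R - kappa) * N w)); last first.
  by move=> w; rewrite add0n /N; ring.
rewrite (@eq_fexp _ _ _ _ q' X us _
    (fun w => 1 + ((expR (- C) - 1) / T%:R) * N w)); last first.
  by move=> w; rewrite add0n /N; ring.
rewrite !lin.
have NT : fexp q' X us N <= T%:R.
  rewrite -(fexp_cst q' X us T%:R); apply: le_fexp => w sw.
  by rewrite ler_nat /T -sw pull_count_le.
set E := fexp q X us N; set E' := fexp q' X us N in NT *.
have T0R : (0 : R) < T%:R by rewrite ltr0n.
have {}NT : E' / T%:R <= 1 by rewrite ler_pdivrMr// mul1r.
have e0 := @expR_gt0 R C.
rewrite expRN -(ler_pM2l e0) mulrA divff ?mul1r ?gt_eqF// => H.
apply: le_trans (_ : (1 + C + (- (1 + C) / T%:R - kappa) * E) + kappa * E <= _).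
  by rewrite le_eqVlt; apply/orP; left; apply/eqP; ring.
rewrite addrC -[leRHS]addrA lerD2l; apply: le_trans H _.
have -> : expR C * (1 + ((expR C)^-1 - 1) / T%:R * E') =
    expR C + (1 - expR C) * (E' / T%:R).
  by field; rewrite !gt_eqF.
lra.
Qed.

End ChangeOfMeasure.

(** * Integration over seeds and arms *)

Section IntegralIid.
Local Open Scope ereal_scope.
Context d (T : measurableType d) (R : realType).

Lemma integral_iidS (P : probability T R) n (f : n.+1.-tuple T -> \bar R) :
  measurable_fun setT f -> (forall w, 0 <= f w) ->
  \int[iid P n.+1]_w f w =
  \int[P]_y \int[iid P n]_w f (cons_pair (y, w)).
Proof.
move=> mf f0; rewrite /= ge0_integral_distribution//.
rewrite fubini_tonelli1.
- by [].
- exact: (measurableT_comp mf (@measurable_cons_pair _ T n)).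
- by move=> y; exact: f0.
Qed.

Lemma integral_iid0 (P : probability T R) (f : 0.-tuple T -> \bar R) :
  measurable_fun setT f -> \int[iid P 0]_w f w = f [tuple].
Proof. by move=> mf; rewrite /= integral_dirac// diracT mul1e. Qed.

End IntegralIid.

Section IntegralFiniteExpectation.
Context (R : realType) d1 d2 (U : measurableType d1) (V : measurableType d2).
Context (L : finType) (q : fdist R L) (X : L -> V).

(** The parameter [z] holds the rounds already taken off the front, as the induction on the length
    requires. *)
Lemma measurable_fexp n d (Z : measurableType d) (phi : Z -> seq (U * V) -> R) :
  measurable_fun setT (fun zw : Z * n.-tuple (U * V) => phi zw.1 zw.2) ->
  measurable_fun setT
    (fun zu : Z * n.-tuple U => fexp q X zu.2 (phi zu.1)).
Proof.
elim: n d Z phi => [|n ih] d Z phi mphi.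
  rewrite (_ : (fun _ => _) = (fun zw : Z * 0.-tuple (U * V) => phi zw.1 zw.2)
      \o (fun zu : Z * 0.-tuple U => (zu.1, [tuple] : 0.-tuple (U * V)))).
    apply: measurableT_comp => //=.
    by apply: measurable_fun_pair => //; exact: measurable_cst.
  by apply/funext => -[z u]/=; rewrite (tuple0 u).
rewrite (_ : (fun _ => _) = (fun zu : Z * n.+1.-tuple U =>
   \sum_l q l * fexp q X (behead zu.2)
     (fun w => phi zu.1 ((thead zu.2, X l) :: w)))%R); last first.
  by apply/funext => -[z u]/=; rewrite (tuple_eta u).
apply: measurable_sum => l; apply: measurable_funM; first exact: measurable_cst.
pose phi' (zu : Z * U) w := phi zu.1 ((zu.2, X l) :: w).
have mphi' : measurable_fun setT
    (fun zw : (Z * U) * n.-tuple (U * V) => phi' zw.1 zw.2).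
  rewrite (_ : (fun _ => _) =
    (fun zw : Z * n.+1.-tuple (U * V) => phi zw.1 zw.2) \o
    (fun zw : (Z * U) * n.-tuple (U * V) =>
       (zw.1.1, [the n.+1.-tuple (U * V) of (zw.1.2, X l) :: zw.2]))) //.
  apply: measurableT_comp => //; apply: measurable_fun_pair.
    exact: (measurableT_comp measurable_fst measurable_fst).
  apply: measurable_cons; last exact: measurable_snd.
  apply: measurable_fun_pair; last exact: measurable_cst.
  exact: (measurableT_comp measurable_snd measurable_fst).
have := ih _ _ _ mphi'.
move=> /(@measurableT_comp _ _ _ _ _ _ _ _ (fun zu : Z * n.+1.-tuple U =>
   ((zu.1, thead zu.2), [tuple of behead zu.2]))); apply.
apply: measurable_fun_pair; last first.
  exact: (measurableT_comp (@measurable_behead _ U n) measurable_snd).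
apply: measurable_fun_pair => //=.
exact: (measurableT_comp (@measurable_tnth _ U n.+1 ord0) measurable_snd).
Qed.

(** Tonelli's theorem, applied one round at a time, pulls the seeds out of the interleaved draws;
    what remains inside is a finite sum for fixed seeds. *)
Lemma integral_iid_finite_law (s : probability U R) n (phi : seq (U * V) -> R) :
  measurable_fun setT (fun w : n.-tuple (U * V) => phi w) ->
  (forall w, 0 <= phi w)%R ->
  (\int[iid (s \x finite_law q X) n]_w (phi w)%:E =
   \int[iid s n]_us (fexp q X us phi)%:E)%E.
Proof.
elim: n phi => [|n ih] phi mphi phi0.
  rewrite !integral_iid0 //; last exact/measurable_EFinP.
  apply: (_ : measurable_fun setT (fun us : 0.-tuple U => (fexp q X us phi)%:E)).
  rewrite (_ : (fun _ => _) = cst (fexp q X [::] phi)%:E) //.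
  by apply/funext => us; rewrite (tuple0 us).
have mphi1 : measurable_fun setT
    (fun zw : (U * V) * n.-tuple (U * V) => phi (zw.1 :: zw.2)).
  have := measurableT_comp mphi (@measurable_cons_pair _ (U * V)%type n).
  exact.
have mphi2 := @measurable_fexp n _ (U * V)%type (fun y w => phi (y :: w)) mphi1.
have fexp0 us f : (forall w, 0 <= f w)%R -> (0 <= (fexp q X us f)%:E)%E.
  move=> f0; rewrite lee_fin -(fexp_cst q X us 0%R).
  by apply: le_fexp => w _; exact: f0.
rewrite integral_iidS; last 2 first.
- exact/measurable_EFinP.
- by move=> w; rewrite lee_fin.
transitivity (\int[s \x finite_law q X]_y
    \int[iid s n]_us (fexp q X us (fun w => phi (y :: w)))%:E)%E.
  apply: eq_integral => y _; rewrite -ih//=.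
  exact: (measurable_fun_pair2 y mphi1).
pose G (zu : (U * V) * n.-tuple U) : \bar R :=
  (fexp q X zu.2 (fun w => phi (zu.1 :: w)))%:E.
have mG : measurable_fun setT G by exact/measurable_EFinP.
have G0 zu : (0 <= G zu)%E by exact: fexp0.
have mF := @measurable_fun_fubini_tonelli_F _ _ _ _ _ (iid s n) G mG G0.
rewrite fubini_tonelli1/=; last 2 first.
- exact: mF.
- by move=> y; apply: integral_ge0 => us _; exact: fexp0.
rewrite integral_iidS; last 2 first.
- apply/measurable_EFinP.
  apply: (measurable_fun_pair2 tt (@measurable_fexp n.+1 _ unit (fun=> phi) _)).
  exact: (measurableT_comp mphi measurable_snd).
- by move=> us; exact: fexp0.
apply: eq_integral => u _.
rewrite /fubini_F integral_finite_law; last 2 first.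
- exact: (measurable_fun_pair2 u mF).
- by move=> x; apply: integral_ge0 => us _; exact: fexp0.
under [RHS]eq_integral => us _ do rewrite /= -sumEFin.
rewrite ge0_integral_sum//; last 2 first.
- move=> l; apply/measurable_EFinP; apply: measurable_funM => //.
  by have := measurable_fun_pair2 (u, X l) mphi2; exact.
- by move=> l us _; rewrite lee_fin mulr_ge0 ?weight_ge0// -lee_fin; exact: fexp0.
apply: eq_bigr => l _; under [RHS]eq_integral do rewrite EFinM.
rewrite ge0_integralZl ?lee_fin ?weight_ge0//.
- apply/measurable_EFinP.
  by have := measurable_fun_pair2 (u, X l) mphi2; exact.
- by move=> us _; exact: fexp0.
Qed.

End IntegralFiniteExpectation.

(** * Measurability of the pull counts *)

Section MeasurabilityOfPulls.
Context (R : realType) (m K : nat).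
Variables (psi : strategy R m K) (A : {set {set 'I_m}}).

(** The choices of a strategy lie in a finite type and their measurability is given by fibres; a
    predicate of a choice holds on a finite union of these. *)
Lemma measurable_fiberP d (Y : measurableType d) (F : finType) (c : Y -> F)
    (P : pred F) :
  (forall S, measurable [set y | c y = S]) -> measurable [set y | P (c y)].
Proof.
move=> mc; rewrite (_ : [set _ | _] = \bigcup_(S in [set S | P S]) [set y | c y = S]).
  by apply: fin_bigcup_measurable => //; exact: finite_finset.
apply/seteqP; split => y; first by exists (c y).
by case=> S PS /= ->.
Qed.

Lemma measurable_fiber_bool d (Y : measurableType d) (F : finType) (c : Y -> F)
    (P : pred F) :
  (forall S, measurable [set y | c y = S]) ->
  measurable_fun setT (fun y => P (c y)).
Proof.
move=> mc; apply: (measurable_fun_bool true); rewrite setTI.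
exact: measurable_fiberP.
Qed.

Lemma measurable_feedback d (Y : measurableType d) (c : Y -> {set 'I_m})
    (x : Y -> m.-tuple R) :
  (forall S, measurable [set y | c y = S]) -> measurable_fun setT x ->
  measurable_fun setT (fun y => feedback (c y) (x y)).
Proof.
move=> mc mx; apply/measurable_fun_tnthP => i.
rewrite (_ : _ \o _ = fun y => if i \in c y then (true, tnth (x y) i)
                               else (false, 0)); last first.
  by apply/funext => y /=; rewrite tnth_mktuple.
apply: measurable_fun_ifT => //=.
- exact: (@measurable_fiber_bool _ _ _ c (fun S => i \in S) mc).
- apply: measurable_fun_pair => //.
  exact: (measurableT_comp (measurable_tnth i) mx).
Qed.

Lemma measurable_rcons d (Y : measurableType d) d' (W : measurableType d') t
    (h : Y -> t.-tuple W) (y : Y -> W) :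
  measurable_fun setT h -> measurable_fun setT y ->
  measurable_fun setT (fun z => [tuple of rcons (h z) (y z)]).
Proof.
move=> mh my; apply/measurable_fun_tnthP => i.
have [it|ti] := ltnP i t.
- rewrite (_ : _ \o _ = (@tnth _ W ^~ (Ordinal it)) \o h).
    by apply: measurableT_comp => //; exact: measurable_tnth.
  apply/funext => z /=; rewrite (tnth_nth (y z)) (tnth_nth (y z)) /=.
  by rewrite nth_rcons size_tuple it.
- rewrite (_ : _ \o _ = y) //; apply/funext => z /=.
  rewrite (tnth_nth (y z)) /= nth_rcons size_tuple ltnNge ti /=.
  by case: eqP.
Qed.

(** The parameter space [Z] grows by one round at each induction step, and the history [h] is a
    function on it. *)
Lemma measurable_pull_count S n t d (Z : measurableType d)
    (h : Z -> t.-tuple (R * m.-tuple (bool * R))) :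
  measurable_fun setT h ->
  measurable_fun setT (fun zw : Z * n.-tuple (R * m.-tuple R) =>
    (pull_count psi A S (h zw.1) zw.2)%:R : R).
Proof.
elim: n t d Z h => [|n ih] t d Z h mh.
  rewrite (_ : (fun _ => _) = cst 0); first exact: measurable_cst.
  by apply/funext => -[z w]/=; rewrite (tuple0 w).
pose c (zy : Z * (R * m.-tuple R)) := Defs.choose psi A (h zy.1, zy.2.1).
have mc S' : measurable [set zy | c zy = S'].
  rewrite -[X in measurable X]setTI.
  have m1 : measurable_fun setT
      (fun zy : Z * (R * m.-tuple R) => (h zy.1, zy.2.1)).
    apply: measurable_fun_pair; first exact: (measurableT_comp mh measurable_fst).
    exact: (measurableT_comp measurable_fst measurable_snd).
  have := m1 measurableT _ (@choose_measurable _ _ _ psi A t S').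
  apply.
pose h' (zy : Z * (R * m.-tuple R)) :=
  [tuple of rcons (h zy.1) (zy.2.1, feedback (c zy) zy.2.2)].
have mh' : measurable_fun setT h'.
  apply: measurable_rcons; first exact: (measurableT_comp mh measurable_fst).
  apply: measurable_fun_pair.
    exact: (measurableT_comp measurable_fst measurable_snd).
  apply: measurable_feedback => //.
  exact: (measurableT_comp measurable_snd measurable_snd).
have m2 : measurable_fun setT (fun zw : Z * n.+1.-tuple (R * m.-tuple R) =>
    ((zw.1, thead zw.2), [tuple of behead zw.2])).
  apply: measurable_fun_pair; last first.
    exact: (measurableT_comp (@measurable_behead _ _ n) measurable_snd).
  apply: measurable_fun_pair => //.
  exact: (measurableT_comp (@measurable_tnth _ _ n.+1 ord0) measurable_snd).
rewrite (_ : (fun _ => _) = (fun zw : Z * n.+1.-tuple (R * m.-tuple R) =>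
   (c (zw.1, thead zw.2) == S)%:R +
   (pull_count psi A S (h' (zw.1, thead zw.2)) [tuple of behead zw.2])%:R));
  last first.
  apply/funext => -[z w]; rewrite (tuple_eta w) /= theadE.
  by case: (thead w) => u x /=; rewrite /c /= chooseE natrD.
apply: measurable_funD; last first.
  exact: (measurableT_comp (ih _ _ _ _ mh') m2).
rewrite (_ : (fun _ => _) = (fun b : bool => b%:R) \o
   ((fun zy => c zy == S) \o
    (fun zw : Z * n.+1.-tuple (R * m.-tuple R) => (zw.1, thead zw.2)))) //.
apply: measurableT_comp => //.
apply: measurableT_comp; first exact: (@measurable_fiber_bool _ _ _ c (pred1 S) mc).
exact: (measurableT_comp measurable_fst m2).
Qed.

Lemma measurable_pull_count0 S n :
  measurable_fun setT (fun w : n.-tuple (R * m.-tuple R) =>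
    (pull_count psi A S [::] w)%:R : R).
Proof.
apply: (measurable_fun_pair2 tt
  (@measurable_pull_count S n 0 _ unit (fun=> [tuple]) _)).
exact: measurable_cst.
Qed.

End MeasurabilityOfPulls.

(** * Expected pulls and regret *)

Section ExpectedPulls.
Context (R : realType) (m K : nat).
Implicit Types (nu : cmab R m K) (psi : strategy R m K) (S : {set 'I_m}).

Lemma measurable_pulls nu psi S T : measurable_fun setT (@pulls R m K nu psi S T).
Proof.
rewrite (_ : @pulls _ _ _ _ _ _ _ =
  fun w : T.-tuple _ => (pull_count psi (actions nu) S [::] w)%:R).
  exact: measurable_pull_count0.
by apply/funext => w; rewrite (@pullsE _ _ _ _ (actions nu)).
Qed.

Lemma pulls_ge0 nu psi S T w : 0 <= @pulls R m K nu psi S T w.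
Proof. by rewrite (@pullsE _ _ _ _ (actions nu)). Qed.

Lemma played_action nu psi w t : played psi (actions nu) w t \in actions nu.
Proof. by apply: choose_action; exact: actionsP. Qed.

Lemma expected_pulls_ge0 nu psi S T : (0 <= expected_pulls nu psi S T)%E.
Proof.
rewrite /expected_pulls expectation.unlock.
by apply: integral_ge0 => w _; rewrite lee_fin pulls_ge0.
Qed.

(** Exactly one action is played in each round. *)
Lemma sum_expected_pulls nu psi T :
  (\sum_(S in actions nu) expected_pulls nu psi S T = T%:R%:E)%E.
Proof.
rewrite /expected_pulls expectation.unlock -big_filter -ge0_integral_sum//; last 2 first.
- by move=> S; apply/measurable_EFinP; exact: measurable_pulls.
- by move=> S w _; rewrite lee_fin pulls_ge0.
rewrite (eq_integral (cst T%:R%:E)) => [|w _].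
  rewrite integral_cst// -[RHS]mule1; congr (_ * _)%E.
  exact: (@probability_setT _ _ _ (run_law nu psi T)).
rewrite big_filter sumEFin /pulls exchange_big /=; congr _%:E.
rewrite -[in RHS](card_ord T) -sum1_card natr_sum; apply: eq_bigr => t _.
rewrite (bigD1 (played psi (actions nu) (run w) t)) ?played_action//= eqxx.
by rewrite big1 ?addr0// => S /andP[_]; rewrite eq_sym => /negbTE ->.
Qed.

Lemma expected_pulls_le nu psi S T :
  S \in actions nu -> (expected_pulls nu psi S T <= T%:R%:E)%E.
Proof.
move=> SA; rewrite -(sum_expected_pulls nu psi) (bigD1 S)//= leeDl//.
by apply: sume_ge0 => S' _; exact: expected_pulls_ge0.
Qed.

Lemma expected_pulls_fin_num nu psi S T :
  S \in actions nu -> expected_pulls nu psi S T \is a fin_num.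
Proof.
move=> SA; rewrite ge0_fin_numE ?expected_pulls_ge0//.
by rewrite (le_lt_trans (expected_pulls_le _ _ SA))// ltry.
Qed.

Lemma gap_ge0 (r : 'rV[R]_K -> R) nu S : 0 <= gap r nu S.
Proof. by rewrite /gap subr_ge0; exact: bigmax_ge_id. Qed.

(** The rounds are grouped by the action played; gaps and pulls are nonnegative, so sums and
    integrals commute. *)
Lemma expected_regretE (r : 'rV[R]_K -> R) nu psi T :
  (expected_regret r nu psi T =
   \sum_(S in actions nu) (gap r nu S)%:E * expected_pulls nu psi S T)%E.
Proof.
rewrite /expected_regret /expected_pulls expectation.unlock.
under eq_bigr => S _.
  rewrite -ge0_integralZl//; last 3 first.
  - by apply/measurable_EFinP; exact: measurable_pulls.
  - by move=> w _; rewrite lee_fin pulls_ge0.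
  - by rewrite lee_fin gap_ge0.
  over.
rewrite -big_filter -ge0_integral_sum//; last 2 first.
- move=> S; apply: emeasurable_funM => //.
  by apply/measurable_EFinP; exact: measurable_pulls.
- by move=> S w _; rewrite mule_ge0// lee_fin ?pulls_ge0 ?gap_ge0.
apply: eq_integral => w _; rewrite big_filter sumEFin; congr _%:E.
rewrite /pulls; under [RHS]eq_bigr do rewrite mulr_sumr.
rewrite exchange_big /=; apply: eq_bigr => t _.
rewrite (bigD1 (played psi (actions nu) (run w) t)) ?played_action//= eqxx mulr1.
rewrite big1 ?addr0// => S /andP[_]; rewrite eq_sym => /negbTE ->.
by rewrite mulr0.
Qed.

Lemma expected_regret_ge0 (r : 'rV[R]_K -> R) nu psi T :
  (0 <= expected_regret r nu psi T)%E.
Proof.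
rewrite expected_regretE; apply: sume_ge0 => S _.
by rewrite mule_ge0 ?expected_pulls_ge0// lee_fin gap_ge0.
Qed.

End ExpectedPulls.

(** * The information inequality with random seeds *)

Section InformationInequality.
Context (R : realType) (m K : nat) (nu nu' : cmab R m K) (psi : strategy R m K).
Variables (L : finType) (q q' : fdist R L) (X : L -> m.-tuple R).
Hypothesis law_nu : law nu = finite_law q X.
Hypothesis law_nu' : law nu' = finite_law q' X.
Hypothesis actions_nu' : actions nu' = actions nu.
Variables (Sa : {set 'I_m}) (g : L -> R) (kappa : R).
Hypothesis Sa_action : Sa \in actions nu.
Hypothesis kappa0 : 0 < kappa.
Hypothesis g0 : forall l, 0 < g l.
Hypothesis q'E : forall l, q' l = g l * q l.
Hypothesis kl_le : - kappa <= \sum_l q l * ln (g l).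
Hypothesis other_actions : forall S, S \in actions nu -> S != Sa ->
  forall phi : m.-tuple (bool * R) -> R,
  \sum_l q' l * phi (feedback S (X l)) = \sum_l q l * phi (feedback S (X l)).

Let N (w : seq (R * m.-tuple R)) : R :=
  (pull_count psi (actions nu) Sa [::] w)%:R.

Lemma expected_pulls_fexp nu0 (q0 : fdist R L) T :
  law nu0 = finite_law q0 X -> actions nu0 = actions nu ->
  (expected_pulls nu0 psi Sa T =
   \int[iid (seed_law psi) T]_us (fexp q0 X us N)%:E)%E.
Proof.
move=> law0 act0; rewrite /expected_pulls expectation.unlock /run_law law0.
rewrite -integral_iid_finite_law//; last exact: measurable_pull_count0.
by apply: eq_integral => w _; rewrite (@pullsE _ _ _ _ (actions nu)).
Qed.

Let measurable_fexp_N (q0 : fdist R L) T :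
  measurable_fun setT (fun us : T.-tuple R => (fexp q0 X us N)%:E).
Proof.
apply/measurable_EFinP.
apply: (measurable_fun_pair2 tt
  (@measurable_fexp _ _ _ _ _ _ q0 X T _ unit (fun=> N) _)).
have := @measurable_pull_count0 _ _ _ psi (actions nu) Sa T.
by move=> /measurableT_comp; apply; exact: measurable_snd.
Qed.

Let fexp_N_ge0 (q0 : fdist R L) us : 0 <= fexp q0 X us N.
Proof.
by rewrite -(fexp_cst q0 X us 0); apply: le_fexp => w _; rewrite /N.
Qed.

(** The seeds have the same law in both problems, so the inequality for fixed seeds can be
    integrated over them. *)
Lemma information_inequality T C : (0 < T)%N -> 0 <= C ->
  (1 + C) * (1 - fine (expected_pulls nu psi Sa T) / T%:R) <=
  kappa * fine (expected_pulls nu psi Sa T) +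
  expR C * (1 - fine (expected_pulls nu' psi Sa T) / T%:R) + 1.
Proof.
move=> T0 C0; have T0R : (0 : R) < T%:R by rewrite ltr0n.
have Sa_action' : Sa \in actions nu' by rewrite actions_nu'.
have affine (q0 : fdist R L) a b : 0 <= a -> 0 <= b ->
    (\int[iid (seed_law psi) T]_us (a + b * fexp q0 X us N)%:E =
     a%:E + b%:E * \int[iid (seed_law psi) T]_us (fexp q0 X us N)%:E)%E.
  move=> a0 b0; under eq_integral do rewrite EFinD EFinM.
  rewrite ge0_integralD//; last 2 first.
  - by move=> us _; rewrite mule_ge0 ?lee_fin.
  - by apply: emeasurable_funM => //; exact: measurable_fexp_N.
  rewrite ge0_integralZl ?lee_fin//; last 2 first.
  - exact: measurable_fexp_N.
  - by move=> us _; rewrite lee_fin.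
  - rewrite integral_cst// -[X in _ = (X + _)%E]mule1; congr (_ * _ + _)%E.
    exact: (@probability_setT _ _ _ (iid (seed_law psi) T)).
(* Subtracted terms are moved across the inequality: both integrands become nonnegative and their
   integrals split by [affine]. *)
have : (\int[iid (seed_law psi) T]_us
      ((1 + C) + expR C / T%:R * fexp q' X us N)%:E <=
    \int[iid (seed_law psi) T]_us
      ((expR C + 1) + (kappa + (1 + C) / T%:R) * fexp q X us N)%:E)%E.
  have pos (p : fdist R L) a b us : 0 <= a -> 0 <= b ->
      (0 <= (a + b * fexp p X us N)%:E)%E.
    by move=> a0 b0; rewrite lee_fin addr_ge0// mulr_ge0.
  have mes (p : fdist R L) a b :
      measurable_fun setT (fun us : T.-tuple R => (a + b * fexp p X us N)%:E).
    apply/measurable_EFinP; apply: measurable_funD => //.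
    by apply: measurable_funM => //; apply/measurable_EFinP; exact: measurable_fexp_N.
  apply: ge0_le_integral => //.
  - by move=> us _; apply: pos; rewrite ?divr_ge0 ?expR_ge0 ?addr_ge0.
  - move=> us _; rewrite lee_fin.
    have := @change_of_measure R m K psi (actions nu) (@actionsP _ _ _ nu) L q q' X
       Sa g kappa g0 q'E kl_le other_actions C us.
    rewrite size_tuple => /(_ T0 C0); cbv zeta; rewrite -/N.
    set F := fexp q X us N; set F' := fexp q' X us N.
    move: (T%:R^-1) F F' (expR C) => ti F F' e H.
    rewrite -subr_ge0 in H; rewrite -subr_ge0; apply: le_trans H _.
    by rewrite le_eqVlt; apply/orP; left; apply/eqP; ring.
rewrite !affine ?divr_ge0 ?expR_ge0 ?addr_ge0 ?expR_ge0 ?(ltW kappa0)//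
  ?divr_ge0 ?addr_ge0//.
rewrite -(expected_pulls_fexp _ law_nu')// -(expected_pulls_fexp _ law_nu)//.
rewrite -(fineK (expected_pulls_fin_num psi T Sa_action)).
rewrite -(fineK (expected_pulls_fin_num psi T Sa_action')).
rewrite -!EFinM -!EFinD lee_fin /=; lra.
Qed.

End InformationInequality.

(** * Logarithmic lower bound on pulls *)

Section LogarithmicPulls.
Context (R : realType) (m K : nat).

Lemma consistent_negligible (r : 'rV[R]_K -> R) (psi : strategy R m K)
    (nu : cmab R m K) S (alpha e : R) :
  consistent r psi -> S \in actions nu -> 0 < gap r nu S ->
  0 < alpha <= 1 -> 0 < e ->
  \forall T \near \oo,
    fine (expected_pulls nu psi S T) <= e * T%:R `^ alpha.
Proof.
move=> cons SA gap0 alpha01 e0.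
have /fine_cvgP[_ /cvgrPdist_le/(_ _ e0)] := cons nu S SA gap0 alpha alpha01.
move=> near_e; near=> T.
have : `|0 - fine (expected_pulls nu psi S T * (T%:R `^ alpha)^-1%:E)| <= e.
  by near: T.
have T0 : (0 : R) < T%:R `^ alpha by rewrite powR_gt0// ltr0n; near: T; exists 1%N.
rewrite sub0r normrN fineM ?expected_pulls_fin_num//=.
by move=> /(le_trans (ler_norm _)); rewrite ler_pdivrMr.
Unshelve. all: by end_near. Qed.

(** Take [C] = ln T / 2. Under [nu'] all actions but [Sa] together are played at most sqrt T times
    in expectation, so the term with [expR C] is at most 1; under [nu] the expected fraction of
    plays of [Sa] is at most 1/4. What remains is 3/4 (1 + ln T / 2) <= kappa N + 2. *)
Lemma log_pulls (r : 'rV[R]_K -> R) (psi : strategy R m K)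
    (nu nu' : cmab R m K) Sa (kappa : R) :
  consistent r psi -> actions nu' = actions nu -> Sa \in actions nu ->
  0 < gap r nu Sa ->
  (forall S, S \in actions nu -> S != Sa -> 0 < gap r nu' S) ->
  (forall T C, (0 < T)%N -> 0 <= C ->
    (1 + C) * (1 - fine (expected_pulls nu psi Sa T) / T%:R) <=
    kappa * fine (expected_pulls nu psi Sa T) +
    expR C * (1 - fine (expected_pulls nu' psi Sa T) / T%:R) + 1) ->
  \forall T \near \oo,
    ln T%:R <= 4 * kappa * fine (expected_pulls nu psi Sa T).
Proof.
move=> cons act SaA gapSa gapS info.
(* With this share of sqrt T for each action other than [Sa], all of them together stay below sqrt
   T. *)
pose eta : R := (#|actions nu|.+1)%:R^-1.
have eta0 : 0 < eta by rewrite invr_gt0 ltr0n.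
have near_S : \forall T \near \oo, forall S, S \in actions nu -> S != Sa ->
    fine (expected_pulls nu' psi S T) <= eta * T%:R `^ 2^-1.
  apply: filter_forall => S.
  have [SA|] := boolP (S \in actions nu); last by move=> _; apply: nearW.
  have [->|SSa] := eqVneq S Sa; first by apply: nearW => T _.
  have half : 0 < (2^-1 : R) <= 1 by lra.
  have SA' : S \in actions nu' by rewrite act.
  have := consistent_negligible cons SA' (gapS _ SA SSa) half eta0.
  by apply: filterS => T HT _ _.
have near_Sa : \forall T \near \oo,
    fine (expected_pulls nu psi Sa T) <= 4^-1 * T%:R `^ 1.
  by apply: (consistent_negligible cons SaA gapSa); lra.
near=> T.
have T0 : (0 < T)%N by near: T; exists 1%N.
have T0R : (0 : R) < T%:R by rewrite ltr0n.
have N4 : fine (expected_pulls nu psi Sa T) <= 4^-1 * T%:R `^ 1.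
  by near: T; exact: near_Sa.
have NS : forall S, S \in actions nu -> S != Sa ->
    fine (expected_pulls nu' psi S T) <= eta * T%:R `^ 2^-1.
  by near: T; exact: near_S.
pose s : R := T%:R `^ 2^-1.
have s0 : 0 < s by rewrite powR_gt0.
(* From 10 on, 3/4 + 3/8 ln T - 2 is at least ln T / 4. *)
have lnT : ln T%:R >= 10 :> R.
  rewrite -[leLHS]expRK ler_ln ?posrE ?expR_gt0//.
  by near: T; exact: nbhs_infty_ger.
have ss : s * s = T%:R.
  rewrite /s -powRD ?(gt_eqF T0R) ?implybT// (_ : 2^-1 + 2^-1 = 1) ?powRr1//.
  by lra.
have lns : ln s = 2^-1 * ln T%:R by rewrite ln_powR.
have := info T (ln s) T0; rewrite lns => /(_ _)/wrap[|]; first by lra.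
rewrite -lns lnK ?posrE//.
set N := fine (expected_pulls nu psi Sa T).
set N' := fine (expected_pulls nu' psi Sa T).
have {}N4 : N / T%:R <= 4^-1 by rewrite powRr1// in N4; rewrite ler_pdivrMr.
have N's : T%:R - N' <= s.
  have /(congr1 fine) := sum_expected_pulls nu' psi T.
  rewrite (bigD1 Sa) ?act//= fineD ?expected_pulls_fin_num ?act//; last first.
    by apply/sum_fin_numP => S _ /andP[SA _]; rewrite expected_pulls_fin_num ?act.
  rewrite -/N' => <-; rewrite addrC addKr -sum_fine; last first.
    by move=> S /andP[SA _]; rewrite expected_pulls_fin_num ?act.
  apply: (@le_trans _ _ (\sum_(S in actions nu | S != Sa) eta * s)).
    by apply: ler_sum => S /andP[SA SSa]; exact: NS.
  rewrite sumr_const -mulr_natr -mulrA mulrC -mulrA ger_pMr//.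
  rewrite /eta ler_pdivrMr ?ltr0n// mul1r ler_nat.
  apply: leq_trans (leqnSn _); apply: subset_leq_card.
  by apply/fintype.subsetP => S /andP[].
have N'1 : s * (1 - N' / T%:R) <= 1.
  rewrite (_ : 1 - N' / T%:R = (T%:R - N') / (s * s)); last first.
    by rewrite ss mulrBl divff ?gt_eqF.
  rewrite (_ : s * _ = (T%:R - N') / s); last by field; rewrite gt_eqF.
  by rewrite ler_pdivrMr// mul1r.
move=> H; have : (1 + ln s) * (3 / 4) <= (1 + ln s) * (1 - N / T%:R).
  by rewrite ler_wpM2l//; lra.
lra.
Unshelve. all: by end_near. Qed.

End LogarithmicPulls.

Lemma limn_einf_ge (R : realType) (u : (\bar R)^nat) (x : \bar R) :
  (\forall n \near \oo, (x <= u n)%E) -> (x <= limn_einf u)%E.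
Proof.
move=> [N _ xu]; rewrite limn_einf_lim; apply: lime_ge; first exact: is_cvg_einfs.
exists N => // n Nn; apply: le_ereal_inf_tmp => _ [k /= nk <-].
by apply: xu; rewrite /= (leq_trans Nn).
Qed.

(** * Tilts of a finite distribution *)

Section Tilting.
Context (R : realType) (L : finType) (q : fdist R L) (f : L -> R).
Hypothesis f_mean : \sum_l q l * f l = 0.

Let tilt_sum1 t : \sum_l q l * (1 + t * f l) = 1.
Proof.
transitivity (\sum_l q l + t * \sum_l q l * f l).
  by rewrite mulr_sumr -big_split; apply: eq_bigr => l _ /=; ring.
by rewrite f_mean mulr0 addr0 weight_sum1.
Qed.

Let tilt_ge0 t : (forall l, 0 <= 1 + t * f l) -> forall l, 0 <= q l * (1 + t * f l).
Proof. by move=> h l; rewrite mulr_ge0 ?weight_ge0. Qed.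

(* The value is junk when some [1 + t * f l] is negative. *)
Definition tilt (t : R) : fdist R L :=
  if pselect (forall l, 0 <= 1 + t * f l) is left h
  then Fdist (tilt_ge0 h) (tilt_sum1 t) else q.

Lemma tiltE t l : (forall l, 0 <= 1 + t * f l) -> tilt t l = q l * (1 + t * f l).
Proof. by move=> h; rewrite /tilt; case: pselect. Qed.

(* [ln x <= x - 1] bounds the Kullback-Leibler divergence between two tilts by
   a chi-square divergence. *)
Lemma tilt_log_ratio (e d B : R) : (forall l, `|f l| <= B) ->
  0 <= e -> 0 <= d -> e * B <= 2^-1 -> d * B <= 50^-1 ->
  - ((e + d) ^+ 2 * (\sum_l q l * f l ^+ 2) * (50 / 49)) <=
  \sum_l tilt (- e) l * ln ((1 + d * f l) / (1 - e * f l)).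
Proof.
move=> fB e0 d0 eB dB.
have ef l : `|e * f l| <= 2^-1.
  by rewrite normrM (ger0_norm e0); apply: le_trans eB; rewrite ler_wpM2l.
have df l : `|d * f l| <= 50^-1.
  by rewrite normrM (ger0_norm d0); apply: le_trans dB; rewrite ler_wpM2l.
have ef0 l : 0 < 1 - e * f l by have := ef l; rewrite ler_norml; lra.
(* The inverse of this lower bound is the factor 50 / 49 of the statement. *)
have df0 l : 49 / 50 <= 1 + d * f l by have := df l; rewrite ler_norml; lra.
have df0' l : 0 < 1 + d * f l by apply: lt_le_trans (df0 l); lra.
have tE l : tilt (- e) l = q l * (1 - e * f l).
  by rewrite tiltE ?mulNr// => l'; rewrite mulNr ltW.
apply: (@le_trans _ _ (\sum_l q l * ((e + d) * f l
    - (e + d) ^+ 2 * (50 / 49) * f l ^+ 2))).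
  rewrite le_eqVlt; apply/orP; left; apply/eqP.
  transitivity ((e + d) * \sum_l q l * f l
    - (e + d) ^+ 2 * (50 / 49) * \sum_l q l * f l ^+ 2).
    by rewrite f_mean; ring.
  by rewrite !mulr_sumr -sumrB; apply: eq_bigr => l _; ring.
apply: ler_sum => l _; rewrite tE -[leRHS]mulrA ler_wpM2l ?weight_ge0//.
have lnle : (e + d) * f l / (1 + d * f l) <= ln ((1 + d * f l) / (1 - e * f l)).
  have := @expR_ge1Dx R (- ln ((1 + d * f l) / (1 - e * f l))).
  rewrite expRN lnK ?posrE ?divr_gt0// invf_div.
  have -> : (1 - e * f l) / (1 + d * f l) = 1 - (e + d) * f l / (1 + d * f l).
    by field; rewrite gt_eqF.
  lra.
apply: le_trans (_ : (1 - e * f l) * ((e + d) * f l / (1 + d * f l)) <= _); last first.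
  by rewrite ler_wpM2l// ltW.
have -> : (1 - e * f l) * ((e + d) * f l / (1 + d * f l)) =
    (e + d) * f l - (e + d) ^+ 2 * (1 + d * f l)^-1 * f l ^+ 2.
  by field; rewrite gt_eqF.
rewrite lerD2l lerN2; apply: ler_wpM2r; first exact: sqr_ge0.
apply: ler_wpM2l; first exact: sqr_ge0.
by rewrite -[leRHS]invf_div lef_pV2 ?posrE//; lra.
Qed.

End Tilting.

(** * Regret when the suboptimal actions have equal laws *)

Section LogarithmicRegret.
Context (R : realType) (m K n : nat) (I : {set 'I_K}).
Hypothesis room : (K + n * #|~: I| <= m)%N.
Hypothesis I_proper : I != [set: 'I_K]%SET.
Context (L : finType) (value : L -> 'rV[R]_K).
Hypothesis value_cube : forall l, cube (value l).
Hypothesis value_shared :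
  forall i, i \in I -> forall l l', value l 0 i = value l' 0 i.
Context (r : 'rV[R]_K -> R) (hr : smooth_index_invariant r).

Definition law_means (p : fdist R L) : 'rV[R]_K :=
  \row_i \sum_l p l * value l 0 i.

Definition gap_laws (qopt qsub : fdist R L) (a : 'I_n.+1) : fdist R L :=
  if a == ord0 then qopt else qsub.

Local Notation mkproblem := (problem room value_cube).

(** Replacing the law of one suboptimal action by [qalt] makes it the only optimal one, so
    [log_pulls] applies to each of the [n] suboptimal actions in turn; every pull of one costs
    [Delta]. *)
Lemma problem_log_regret (qopt qsub qalt : fdist R L) (g : L -> R) (kappa Delta : R)
    (psi : strategy R m K) :
  0 < kappa -> 0 < Delta ->
  r (law_means qsub) = r (law_means qopt) - Delta ->
  r (law_means qopt) < r (law_means qalt) ->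
  (forall l, 0 < g l) -> (forall l, qalt l = g l * qsub l) ->
  - kappa <= \sum_l qsub l * ln (g l) ->
  consistent r psi ->
  \forall T \near \oo,
    ((n%:R * Delta / (4 * kappa) * ln T%:R)%:E <=
     expected_regret r (mkproblem (gap_laws qopt qsub)) psi T)%E.
Proof.
move=> k0 D0 rsub ralt g0 altE kl cons.
set q := gap_laws qopt qsub; set nu := mkproblem q.
have gapE a : a != ord0 -> gap r nu (action room a) = Delta.
  move=> a0; rewrite (@gap_action _ _ _ _ _ room _ _ value_cube value_shared r q a ord0 hr).
    rewrite /action_means -!/(law_means _) /q /gap_laws eqxx (negbTE a0) rsub; ring.
  move=> c; rewrite /action_means -!/(law_means _) /q /gap_laws eqxx.
  by case: ifP => // _; rewrite rsub gerBl ltW.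
have near_a : \forall T \near \oo, forall a, a != ord0 ->
    ln T%:R <= 4 * kappa * fine (expected_pulls nu psi (action room a) T).
  apply: filter_forall => a; have [->|a0] := eqVneq a ord0; first exact: nearW.
  pose q' b := if b == a then qalt else q b.
  pose nu' := mkproblem q'.
  have qa : q a = qsub by rewrite /q /gap_laws (negbTE a0).
  have gap' S : S \in actions nu -> S != action room a -> 0 < gap r nu' S.
    move=> /finset.imsetP[b _ ->] bSa.
    have ba : b != a by apply: contraNneq bSa => ->.
    have opt' c : r (action_means value q' c) <= r (action_means value q' a).
      rewrite /action_means -!/(law_means _) /q' eqxx; case: ifP => // _.
      by rewrite /q /gap_laws; case: ifP => // _; rewrite ?rsub; lra.
    rewrite (@gap_action _ _ _ _ _ room _ _ value_cube value_shared r q' b a hr opt').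
    rewrite /action_means -!/(law_means _) /q' eqxx (negbTE ba) subr_gt0.
    by rewrite /q /gap_laws; case: ifP => // _; rewrite ?rsub; lra.
  have gapa : 0 < gap r nu (action room a) by rewrite gapE.
  have aA : action room a \in actions nu by exact: action_in.
  have := @log_pulls R m K r psi nu nu' (action room a) kappa cons erefl aA gapa gap'.
  have W : forall T C, (0 < T)%N -> 0 <= C ->
    (1 + C) * (1 - fine (expected_pulls nu psi (action room a) T) / T%:R) <=
    kappa * fine (expected_pulls nu psi (action room a) T) +
    expR C * (1 - fine (expected_pulls nu' psi (action room a) T) / T%:R) + 1.
    (* The levels are independent, so the likelihood ratio of the two problems depends on the level
       of action [a] alone. *)
    apply: (@information_inequality R m K nu nu' psi _ (prod_fdist q) (prod_fdist q')
       (arms room value) erefl erefl erefl (action room a) (fun w => g (w a))) => //.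
    - move=> w /=; rewrite (bigD1 a)//= /q' eqxx altE [in RHS](bigD1 a)//= mulrA qa.
      by congr (_ * _); apply: eq_bigr => b /negbTE ->.
    - by rewrite (prod_fdist_marginal q a (fun l => ln (g l))) qa.
    - move=> S /finset.imsetP[b _ ->] bSa phi.
      apply: (sum_feedback room value_shared) => l; rewrite /q'.
      by have [ba|//] := eqVneq b a; rewrite ba eqxx in bSa.
  by move=> /(_ W); apply: filterS => T HT _.
near=> T.
have HT : forall a, a != ord0 ->
    ln T%:R <= 4 * kappa * fine (expected_pulls nu psi (action room a) T).
  by near: T.
rewrite expected_regretE.
have fin S : S \in actions nu -> expected_pulls nu psi S T \is a fin_num.
  by move=> SA; rewrite expected_pulls_fin_num.
rewrite (eq_bigr (fun S => (gap r nu S * fine (expected_pulls nu psi S T))%:E));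
  last first.
  by move=> S SA; rewrite EFinM fineK// fin.
rewrite sumEFin lee_fin (big_imset _ (in2W (action_inj I_proper)))/=.
rewrite (bigD1 ord0)//=; apply: ler_wpDl.
  by rewrite mulr_ge0 ?gap_ge0 ?fine_ge0 ?expected_pulls_ge0.
apply: (@le_trans _ _ (\sum_(a < n.+1 | a != ord0) Delta * (ln T%:R / (4 * kappa)))).
  rewrite sumr_const (_ : #|_| = n); last first.
    by have := cardC1 (@ord0 n); rewrite card_ord.
  by rewrite -mulr_natl le_eqVlt; apply/orP; left; apply/eqP; ring.
apply: ler_sum => a a0; rewrite gapE// ler_wpM2l ?(ltW D0)//.
by rewrite ler_pdivrMr ?mulr_gt0// mulrC; exact: HT.
Unshelve. all: by end_near. Qed.

End LogarithmicRegret.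

(** * Two actions with deterministic arms *)

Section TwoActionProblem.
Context (R : realType) (m K : nat) (r : 'rV[R]_K -> R).
Hypothesis hr : smooth_index_invariant r.

Lemma point_fdist_subproof (L : finType) (l0 : L) :
  \sum_l (l == l0)%:R = 1 :> R.
Proof. by rewrite (bigD1 l0)//= eqxx big1 ?addr0// => l /negbTE ->. Qed.

Definition point_fdist (L : finType) (l0 : L) : fdist R L :=
  Fdist (fun l => ler0n R (l == l0)) (point_fdist_subproof l0).

Lemma sum_point_fdist (L : finType) (l0 : L) (phi : L -> R) :
  \sum_l point_fdist l0 l * phi l = phi l0.
Proof.
by rewrite (bigD1 l0)//= eqxx mul1r big1 ?addr0// => l /negbTE ->; rewrite mul0r.
Qed.

(** The optimal action pays [mu], the other one [y], and they share the positions where the two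
    vectors agree. The count of differing coordinates in [attainable_gap] is exactly the room
    required for [n = 1]. *)
Lemma two_action_problem (mu : 'rV[R]_K) (Delta : R) :
  (K <= m)%N -> cube mu -> 0 < Delta -> attainable_gap m r mu Delta ->
  exists (nu : cmab R m K) (J : {set 'I_m}),
    [/\ disjoint_over J nu, minimal_gap r nu = Delta%:E &
        exists2 Sopt : {set 'I_m}, optimal r nu Sopt & means_on nu Sopt = mu].
Proof.
move=> Km cmu D0 [y [cy ydiff ry]].
pose I := [set i | y 0 i == mu 0 i]%SET.
have room : (K + 1 * #|~: I| <= m)%N.
  rewrite mul1n -leq_subRL// ?(leq_trans _ ydiff)//.
  by apply: subset_leq_card; apply/fintype.subsetP => i; rewrite !inE.
pose value (b : bool) := if b then mu else y.
have value_cube b : cube (value b) by case: b.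
have value_shared i : i \in I -> forall b b', value b 0 i = value b' 0 i.
  by rewrite inE => /eqP e [] [] //=; rewrite e.
pose q (a : 'I_2) := point_fdist (a == ord0).
have qE a : action_means value q a = value (a == ord0).
  by apply/rowP => i; rewrite mxE sum_point_fdist.
have q0 a : a != ord0 -> r (action_means value q a) = r (action_means value q ord0) - Delta.
  by move=> /negbTE a0; rewrite !qE eqxx a0.
exists (problem room value_cube q), (shared room); split.
- exact: problem_disjoint.
- exact: problem_minimal_gap.
- exists (action room ord0).
    apply: problem_optimal => // c.
    by have [->//|/q0 ->] := eqVneq c ord0; rewrite gerBl ltW.
  by rewrite means_on_action0// qE eqxx.
Qed.

End TwoActionProblem.

(** * Number of actions and size of the tilts *)

Lemma quotient_room (m K k : nat) : (0 < k <= K)%N -> (2 * K < m)%N ->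
  exists n : nat, [/\ (0 < n)%N, (K + n * k <= m)%N & (m <= n * k + 2 * K)%N].
Proof.
(* The remainder of this division is below [k <= K], so rounding loses at most a further [K] arms:
   hence m - 2 K in the bound. *)
move=> /andP[k0 kK] Km; exists ((m - K) %/ k)%N; split.
- by rewrite divn_gt0//; lia.
- by have := leq_trunc_div (m - K) k; lia.
- by have := ltn_ceil (m - K) k0; lia.
Qed.

Lemma tilt_gt0 (R : realType) (t x B : R) :
  `|x| <= B -> `|t| * B <= 2^-1 -> 0 < 1 - t * x.
Proof.
move=> xB tB; have : `|t * x| <= 2^-1.
  by rewrite normrM; apply: le_trans tB; rewrite ler_wpM2l.
by rewrite ler_norml; lra.
Qed.

(** The reward has slope [g2] along [v]: a small step forward increases it, and on the way back the
    intermediate value theorem finds a drop of exactly [Delta]. *)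
Lemma opposite_tilts (R : realType) (K : nat) (r : 'rV[R]_K -> R)
    (p v : 'rV[R]_K) (g2 B : R) :
  smooth_index_invariant r -> cube p -> 0 < g2 ->
  \sum_i gradient r p 0 i * v 0 i = g2 -> 0 < B ->
  (forall t : R, `|t| * B <= 2^-1 -> cube (p + t *: v)) ->
  exists2 rho : R, 0 < rho & forall Delta : R, 0 < Delta <= rho ->
  exists e d : R,
    [/\ 0 <= e /\ e * B <= 2^-1, 0 < d /\ d * B <= 50^-1,
        (e + d) ^+ 2 * g2 * (50 / 49) <= 2 * Delta ^+ 2 / g2,
        r (p + (- e) *: v) = r p - Delta & r p < r (p + d *: v)].
Proof.
move=> hr cp g20 dot B0 cube_v.
have g25 : 0 < g2 / 5 by rewrite divr_gt0.
have [rho rho0 hrho] := directional_expansion v (is_gradient_gradient hr cp) g25.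
rewrite dot in hrho.
(* The second bound keeps [|t| * B] at most 1/2, so that the points [p + t *: v] stay in the
   cube. *)
pose rho' := Num.min rho (2 * B)^-1.
have rho'0 : 0 < rho' by rewrite lt_min rho0 invr_gt0 mulr_gt0.
exists (4 / 5 * g2 * rho'); first by rewrite !mulr_gt0.
move=> Delta /andP[D0 Dle].
(* The expansion errs by at most a fifth of the slope, so a step back by [e1] loses at least 4/5 e1
   g2 = Delta. *)
pose e1 := 5 / 4 * (Delta / g2).
have e1g : e1 * g2 = 5 / 4 * Delta by rewrite /e1; field; rewrite gt_eqF.
have e1le : e1 <= rho'.
  by rewrite /e1 mulrA ler_pdivrMr//; lra.
have e10 : 0 < e1 by rewrite !mulr_gt0 ?invr_gt0.
have D1 : Delta / g2 = 4 / 5 * e1 by rewrite /e1; field; rewrite gt_eqF.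
have D2 : Delta ^+ 2 / g2 = (4 / 5 * e1) ^+ 2 * g2.
  by rewrite -D1; field; rewrite gt_eqF.
have small (t : R) : `|t| <= e1 -> `|t| <= rho /\ `|t| * B <= 2^-1.
  move=> /le_trans/(_ e1le); rewrite le_min => /andP[-> tB]; split => //.
  by rewrite -ler_pdivlMr// -invfM.
have e1B : e1 * B <= 2^-1 by have [//|_] := small e1; rewrite gtr0_norm.
have expand (t : R) : `|t| <= e1 -> `|r (p + t *: v) - r p - t * g2| <= g2 / 5 * `|t|.
  by move=> /small[t1 t2]; apply: hrho => //; exact: cube_v.
clearbody e1; clear e1le small rho' rho'0 Dle hrho rho rho0 dot.
have [e e01 re] : exists2 e, 0 <= e <= e1 & r (p + (- e) *: v) = r p - Delta.
  have cont : {within `[- e1, 0], continuous (fun t => r (p + t *: v))}.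
    apply: directional_continuity => // t t01; apply: cube_v.
    apply: le_trans e1B; apply: ler_wpM2r; first exact: ltW.
    by rewrite ler_norml; lra.
  have := @IVT R _ (- e1) 0 (r p - Delta) _ cont.
  have := expand (- e1); rewrite normrN (gtr0_norm e10) lexx => /(_ isT).
  rewrite scale0r addr0 ler_norml => /andP[_ H].
  have H' : r (p + - e1 *: v) <= r p - Delta by lra.
  rewrite ge_min le_max H' /= => /(_ _ _)[||c].
  - by rewrite oppr_le0 ltW.
  - by apply/orP; right; rewrite gerBl ltW.
  - rewrite in_itv /= => c01 rc; exists (- c); first by lra.
    by rewrite opprK.
(* With [d = e1 / 25] one has [d * B <= 50^-1], and (26/25)^2 (50/49) e1^2, about 1.104 e1^2, stays
   below 2 (4/5)^2 e1^2 = 1.28 e1^2. *)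
have d0 : 0 < e1 / 25 by rewrite divr_gt0.
exists e, (e1 / 25); split => //.
- split; first by case/andP: e01.
  by apply: le_trans e1B; apply: ler_wpM2r; [exact: ltW|case/andP: e01].
- by split => //; rewrite mulrAC; lra.
- rewrite -[leRHS]mulrA D2 [leRHS]mulrA.
  rewrite mulrAC.
  apply: ler_wpM2r; first exact: ltW.
  apply: (@le_trans _ _ ((e1 + e1 / 25) ^+ 2 * (50 / 49))).
    by apply: ler_wpM2r => //; rewrite ler_sqr ?nnegrE; lra.
  by have := sqr_ge0 e1; lra.
- have := expand (e1 / 25); rewrite (gtr0_norm d0) => /(_ _)/wrap[|]; first by lra.
  rewrite ler_norml => /andP[H _].
  have : 0 < e1 / 25 * g2 by rewrite mulr_gt0.
  lra.
Qed.

(** * The instance built from the threshold model *)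

Section GiniProblem.
Context (R : realType) (m K : nat) (r : 'rV[R]_K -> R).
Hypothesis hr : smooth_index_invariant r.
Context (mu : 'rV[R]_K) (cmu : cube mu).
Implicit Type I : {set 'I_K}.

Lemma sorted_outside_cube I : cube (sorted_outside mu I).
Proof. by have [s [ps _]] := sorted_outside_perm mu I; move=> j; rewrite ps. Qed.

Lemma sorted_outside_le I (i j : 'I_K) : (i <= j < K - #|I|)%N ->
  sorted_outside mu I 0 i <= sorted_outside mu I 0 j.
Proof. by rewrite card_setC_sub; exact: sorted_outside_mono. Qed.

(** Sorting makes the means admissible for the threshold model. As a variance the quantity is
    nonnegative, which its formula does not show. *)
Lemma gini_variance I :
  let p := sorted_outside mu I in let D := gradient r p in
  gini_smoothness_sq r mu I =
  \sum_l level_fdist (sorted_outside_cube I) (@sorted_outside_le I) l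
    * score p D (K - #|I|)%N l ^+ 2.
Proof. by move=> p D; rewrite score_variance. Qed.

Lemma gini_smoothness_sq_ge0 I : 0 <= gini_smoothness_sq r mu I.
Proof.
rewrite gini_variance; apply: sumr_ge0 => l _.
by rewrite mulr_ge0 ?weight_ge0 ?sqr_ge0.
Qed.

Lemma gini_problem (I : {set 'I_K}) : (2 * K < m)%N -> I \proper [set: 'I_K]%SET ->
  0 < gini_smoothness_sq r mu I ->
  exists2 rho : R, 0 < rho & forall Delta : R, 0 < Delta <= rho ->
  exists (nu : cmab R m K) (J : {set 'I_m}),
    [/\ disjoint_over J nu, minimal_gap r nu = Delta%:E,
        exists2 Sopt : {set 'I_m}, optimal r nu Sopt & means_on nu Sopt = mu &
        forall psi : strategy R m K, consistent r psi ->
        \forall T \near \oo,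
          (((m%:R - 2 * K%:R) * gini_smoothness_sq r mu I
             / (8 * (K - #|I|)%N%:R * Delta) * ln T%:R)%:E
           <= expected_regret r nu psi T)%E].
Proof.
move=> Km Iproper; set g2 := gini_smoothness_sq r mu I => g20.
set p := sorted_outside mu I; set k := (K - #|I|)%N; set D := gradient r p.
have cp : cube p := sorted_outside_cube I.
have [s [ps sI]] := sorted_outside_perm mu I.
have k0 : (0 < k)%N by rewrite subn_gt0 -[ltnRHS]card_ord -cardsT proper_card.
have I_T : I != [set: 'I_K]%SET.
  by apply: contraTneq Iproper => ->; rewrite fintype.properxx.
pose q := level_fdist cp (@sorted_outside_le I).
pose f := score p D k; pose v := score_cov D cp (@sorted_outside_le I).
have f_mean : \sum_l q l * f l = 0 by exact: score_mean.
have g2E : g2 = \sum_l q l * f l ^+ 2 by rewrite /g2 gini_variance.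
(* Thresholds are attached to sorted positions, hence [s^-1]; the arms at positions in [I] are
   deterministic. *)
pose value (l : 'I_K.+1) : 'rV[R]_K :=
  \row_i (if i \in I then mu 0 i else (l <= (s^-1)%g i)%:R).
have value_cube l : cube (value l).
  by move=> i; rewrite mxE; case: ifP => // _; rewrite ler0n lern1 leq_b1.
have value_shared i : i \in I -> forall l l', value l 0 i = value l' 0 i.
  by move=> iI l l'; rewrite !mxE iI.
pose law t := tilt f_mean t.
(* Up to sorting, the means of the tilted law are exactly affine in [t], with velocity
   [score_cov]. *)
have means_tilt t : (forall l, 0 <= 1 + t * f l) ->
    col_perm s (law_means value (law t)) = p + t *: v.
  move=> ht; apply/rowP => j.
  rewrite [LHS]mxE [LHS]mxE [RHS]mxE [X in _ = _ + X]mxE [X in t * X]mxE.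
  have [kj|jk] := leqP k j.
    have jI : s j \in I by rewrite sI -card_setC_sub.
    transitivity (\sum_l law t l * mu 0 (s j)).
      by apply: eq_bigr => l _; rewrite mxE jI.
    by rewrite -mulr_suml weight_sum1 mul1r mulr0 addr0 /p ps.
  have jI : s j \in I = false by rewrite sI -card_setC_sub leqNgt jk.
  rewrite -[p 0 j](@level_fdist_le _ _ _ _ cp (@sorted_outside_le I) j jk).
  rewrite mulr_sumr -big_split; apply: eq_bigr => l _.
  rewrite mxE jI permK /law tiltE//.
  rewrite -[RHS]/(q l * (l <= j)%:R + t * (q l * (f l * (l <= j)%:R))); ring.
have means_cube (pr : fdist R 'I_K.+1) : cube (law_means value pr).
  exact: (action_means_cube value_cube (fun _ : 'I_1 => pr) ord0).
have reward_tilt t : (forall l, 0 <= 1 + t * f l) ->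
    r (law_means value (law t)) = r (p + t *: v).
  by move=> ht; rewrite -means_tilt// hr.2.
have cube_tilt t : (forall l, 0 <= 1 + t * f l) -> cube (p + t *: v).
  by move=> ht; rewrite -means_tilt// => i; rewrite mxE; exact: means_cube.
pose B : R := 1 + \sum_l `|f l|.
have fB l : `|f l| <= B.
  by rewrite /B (bigD1 l)//= addrCA lerDl addr_ge0// sumr_ge0.
have B0 : 0 < B by rewrite ltr_pwDl// sumr_ge0.
have pos (t : R) : `|t| * B <= 2^-1 -> forall l, 0 <= 1 + t * f l.
  move=> tB l; have : `|t * f l| <= 2^-1.
    by rewrite normrM; apply: le_trans tB; rewrite ler_wpM2l.
  rewrite ler_norml => /andP[+ _]; rewrite -lerBlDl sub0r; apply: le_trans.
  by rewrite lerN2 invf_le1// ler1n.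
have dot : \sum_i D 0 i * v 0 i = g2 by rewrite g2E; exact: score_cov_dot.
have [rho rho0 Hrho] := opposite_tilts hr cp g20 dot B0
  (fun t tB => cube_tilt t (pos t tB)).
exists rho => // Delta Delta_le; have /andP[D0 _] := Delta_le.
have [e [d [[e0 eB] [d0 dB] ed re rd]]] := Hrho Delta Delta_le.
have pos0 : forall l, 0 <= 1 + 0 * f l by move=> l; rewrite mul0r addr0.
have tilt_e : forall l, 0 <= 1 + (- e) * f l by apply: pos; rewrite normrN ger0_norm.
have posd : forall l, 0 <= 1 + d * f l.
  by apply: pos; rewrite gtr0_norm// (le_trans dB)// lef_pV2 ?posrE// ler_nat.
have kI : k = #|~: I| by exact: card_setC_sub.
have kK : (0 < k <= K)%N by rewrite k0 leq_subr.
have [n [n0 nk mn]] := quotient_room kK Km.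
have room : (K + n * #|~: I| <= m)%N by rewrite -kI.
have law0 : law_means value (law 0) = mu.
  have := means_tilt 0 pos0; rewrite scale0r addr0 => /rowP H.
  by apply/rowP => i; have := H ((s^-1)%g i); rewrite mxE permKV ps permKV.
have r0 : r (law_means value (law 0)) = r p.
  by rewrite reward_tilt// scale0r addr0.
pose qs : 'I_n.+1 -> fdist R 'I_K.+1 := gap_laws (law 0) (law (- e)).
have qsub a : a != ord0 ->
    r (action_means value qs a) = r (action_means value qs ord0) - Delta.
  move=> /negbTE a0; rewrite /action_means -!/(law_means _ _) /qs /gap_laws eqxx a0.
  by rewrite r0 reward_tilt.
exists (problem room value_cube qs), (shared room); split.
- exact: problem_disjoint.
- exact: problem_minimal_gap.
- exists (action room ord0).
    apply: problem_optimal => // c.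
    by have [->//|/qsub ->] := eqVneq c ord0; rewrite gerBl ltW.
  by rewrite means_on_action0// -law0.
move=> psi cons.
(* The density of the tilt by [d] with respect to the tilt by [- e]. *)
pose g l := (1 + d * f l) / (1 - e * f l).
have ef l : 0 < 1 - e * f l by apply: tilt_gt0 (fB l) _; rewrite ?ger0_norm.
have df l : 0 < 1 + d * f l.
  rewrite -[d]opprK mulNr; apply: tilt_gt0 (fB l) _; rewrite normrN gtr0_norm//.
  by rewrite (le_trans dB)// lef_pV2 ?posrE// ler_nat.
pose kappa := 2 * Delta ^+ 2 / g2.
have kappa0 : 0 < kappa by rewrite /kappa !mulr_gt0 ?invr_gt0 ?exprn_gt0.
have kl : - kappa <= \sum_l law (- e) l * ln (g l).
  by apply: le_trans (tilt_log_ratio f_mean fB e0 (ltW d0) eB dB); rewrite lerN2 -g2E.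
have g0 l : 0 < g l by rewrite divr_gt0.
have lawdE l : law d l = g l * law (- e) l.
  by rewrite /law !tiltE// /g mulNr; field; rewrite gt_eqF.
have re' : r (law_means value (law (- e))) = r (law_means value (law 0)) - Delta.
  by rewrite r0 reward_tilt.
have rd' : r (law_means value (law 0)) < r (law_means value (law d)).
  by rewrite r0 reward_tilt.
have near_regret := problem_log_regret room I_T value_cube value_shared hr
  kappa0 D0 re' rd' g0 lawdE kl cons.
near=> T.
apply: (@le_trans _ _ (n%:R * Delta / (4 * kappa) * ln T%:R)%:E); last by near: T.
have lnT : 0 <= ln (T%:R : R).
  by apply: ln_ge0; rewrite ler1n; near: T; exists 1%N.
rewrite lee_fin ler_wpM2r//.
(* Since [kappa] is 2 Delta^2 / g2, the factor is n g2 / (8 Delta); extending by [k] prepares the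
   use of m - 2 K <= n k. *)
have -> : n%:R * Delta / (4 * kappa) = (n * k)%:R * g2 / (8 * k%:R * Delta).
  rewrite natrM /kappa; field.
  by rewrite !gt_eqF//= ?ltr0n.
have k0R : (0 : R) < k%:R by rewrite ltr0n.
rewrite ler_wpM2r ?invr_ge0//; first by rewrite !mulr_ge0// ltW.
by rewrite ler_wpM2r ?(ltW g20)// -natrM lerBlDr -natrD ler_nat.
Unshelve. all: by end_near. Qed.

End GiniProblem.

(** * The lower bound for the maximum over all sets I *)

Theorem theorem1 (R : realType) (m K : nat) (hK : (1 <= K)%N) (hKm : (K <= m)%N)
    (r : 'rV[R]_K -> R) (hr : smooth_index_invariant r)
    (mu : 'rV[R]_K) (hmu : cube mu) :
  \forall Delta \near (0 : R)^'+, attainable_gap m r mu Delta ->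
  exists (nu : cmab R m K) (J : {set 'I_m}),
    [/\ disjoint_over J nu,
        minimal_gap r nu = Delta%:E,
        (exists2 Sopt : {set 'I_m}, optimal r nu Sopt & means_on nu Sopt = mu) &
        forall psi : strategy R m K, consistent r psi ->
          (\big[maxe/-oo]_(I : {set 'I_K} | I \proper [set: 'I_K]%SET)
             ((m%:R - 2 * K%:R) * gini_smoothness_sq r mu I
                / (8 * (K - #|I|)%N%:R * Delta))%:E
           <= limn_einf (fun T : nat =>
                expected_regret r nu psi T * ((ln T%:R)^-1)%:E))%E].
Proof.
have ge0 := gini_smoothness_sq_ge0 r hmu.
pose F (I : {set 'I_K}) : R := gini_smoothness_sq r mu I / (K - #|I|)%N%:R.
have F0 (I : {set 'I_K}) : 0 <= F I by rewrite divr_ge0.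
have proper0 : finset.set0 \proper [set: 'I_K]%SET.
  by rewrite properEcard finset.sub0set cards0 cardsT card_ord.
(* The maximiser does not depend on [Delta], so the instance for this one set serves the whole
   maximum for all small [Delta]. *)
pose Imax := [arg max_(I > finset.set0 | I \proper [set: 'I_K]%SET) F I]%O.
have [Imax_proper Fmax] : Imax \proper [set: 'I_K]%SET /\
    forall I : {set 'I_K}, I \proper [set: 'I_K]%SET -> F I <= F Imax.
  by rewrite /Imax; case: arg_maxP.
have termE (Delta : R) (I : {set 'I_K}) : (m%:R - 2 * K%:R) * gini_smoothness_sq r mu I
    / (8 * (K - #|I|)%N%:R * Delta) = (m%:R - 2 * K%:R) * F I / (8 * Delta).
  by rewrite /F !invfM; ring.
(* If either condition fails, every term of the maximum is at most 0 and nonnegativity of the regret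
   suffices. *)
have [/andP[Km g0]|trivial_bound] :=
    boolP ((2 * K < m)%N && (0 < gini_smoothness_sq r mu Imax)).
  have [rho rho0 Hrho] := gini_problem hr hmu Km Imax_proper g0.
  near=> Delta => _.
  have D0 : 0 < Delta by near: Delta; exact: nbhs_right_gt.
  have [|nu [J [dis mg opt Hreg]]] := Hrho Delta.
    by rewrite D0 /=; near: Delta; exact: nbhs_right_le.
  exists nu, J; split => // psi cons.
  apply: (@le_trans _ _ ((m%:R - 2 * K%:R) * F Imax / (8 * Delta))%:E).
    apply: bigmax_le => [|I Ip]; first exact: leNye.
    rewrite lee_fin termE ler_wpM2r ?invr_ge0 ?mulr_ge0 ?(ltW D0)//.
    rewrite ler_wpM2l ?Fmax// subr_ge0 -natrM ler_nat; exact: ltnW.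
  apply: limn_einf_ge; near=> T.
  have lnT : 0 < ln (T%:R : R).
    by apply: ln_gt0; rewrite ltr1n; near: T; exists 2%N.
  rewrite lee_pdivlMr// -termE -EFinM.
  by near: T; exact: Hreg.
near=> Delta => att.
have D0 : 0 < Delta by near: Delta; exact: nbhs_right_gt.
have [nu [J [dis mg opt]]] := two_action_problem hr hKm hmu D0 att.
exists nu, J; split => // psi _.
apply: (@le_trans _ _ 0%E).
  apply: bigmax_le => [|I Ip]; first exact: leNye.
  rewrite lee_fin termE; apply: mulr_le0_ge0; last by rewrite invr_ge0 mulr_ge0// ltW.
  move: trivial_bound; rewrite negb_and -leqNgt -leNgt => /orP[mK|Imax0].
    by rewrite mulr_le0_ge0// subr_le0 -natrM ler_nat.
  have FI : F I = 0.
    apply/eqP; rewrite eq_le F0 andbT; apply: le_trans (Fmax I Ip) _.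
    by rewrite /F mulr_le0_ge0.
  by rewrite FI mulr0.
apply: limn_einf_ge; near=> T.
rewrite mule_ge0 ?expected_regret_ge0// lee_fin invr_ge0 ln_ge0// ler1n.
by near: T; exists 1%N.
Unshelve. all: by end_near. Qed.
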